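(* Let $\alpha\in\mathbb{R}$ and $\mu>0$, and set $c = 1-\frac{\alpha}{2}$. On the punctured Newtonian plane $\mathbb{R}^2\setminus\{0\}\cong\mathbb{C}\setminus\{0\}$, with coordinate $q=(x,y)=x+iy=re^{i\theta}$, consider the Jacobi-Maupertuis metric $$ds_\alpha^2=\frac{|dq|^2}{|q|^\alpha},\qquad |dq|^2=dx^2+dy^2 .$$ A. Up to reparameterization, the geodesics of $ds_\alpha^2$ are the zero energy solutions of the $\alpha$-power law problem $$\ddot q=-\mu\alpha\,\frac{q}{|q|^{\alpha+2}},$$ where the energy is $E=\frac12|\dot q|^2-\frac{\mu}{|q|^{\alpha}}$. B. If $\alpha\neq 2$, then $ds_\alpha^2$ is isometric to the conical metric $$ds_{cone}^2=d\rho^2+c^2\rho^2\,d\theta^2 .$$ This is the metric of a two-dimensional cone of angle $2\pi|c|$. Here $(\rho,\theta)$ are polar coordinates on the plane, and they are related to the polar coordinates $(r,\theta)$ of $q=re^{i\theta}$ on the Newtonian plane by $\rho=r^{c}$. C. Again with $\alpha\ne 2$, the (in general multivalued) map $Q\mapsto q=Q^{1/c}$ takes straight lines on the folding plane, and hence geodesics on the cone of part B, to zero energy solutions (up to reparameterization) of the $\alpha$-power law problem of part A.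
   Context: Everything is considered away from the origin (collision point) $q=0$. The $\alpha$-power law problem is Newton's equation $\ddot q=-\nabla V(q)$ in the plane with potential $V(q)=-\mu/|q|^\alpha$. The folding plane is a Euclidean plane $\mathbb{C}$ with coordinate $Q=u+iv=\rho e^{i\psi}$ and flat metric $|dQ|^2=du^2+dv^2=d\rho^2+\rho^2d\psi^2$. Its angle $\psi$ is related to the angle $\theta$ of the cone by $\theta=\psi/c$, with $\psi$ regarded as a real variable along curves. Via $(\rho,\psi)\mapsto(\rho,\theta)=(\rho,\psi/c)$, curves in the folding plane avoiding $0$ map to curves on the cone (the folding map), straight lines going to geodesics of $ds^2_{cone}$. Convention for the multivalued map: for a curve $Q(\tau)$ avoiding the origin, its image under $Q\mapsto Q^{1/c}$ means a curve obtained by choosing one value of $Q^{1/c}$ at one point and continuing it analytically along the curve. Different choices give images differing by a rotation about $0$. For a line through the origin, this is applied to each of the two open rays obtained by removing the origin.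
   Formalization: In part B, ρ=r^c pulls the conical metric back to c² times ds_α², so it is an isometry only if |c|=1; the formal theorem proves the isometry with ρ=r^c/|c|, and that ρ=r^c is a diffeomorphism scaling the metric by exactly c². *)

(* Defs.v *)
From Stdlib Require Import Reals ZArith.
From Coquelicot Require Import Coquelicot.
Open Scope R_scope.

(* Points of the plane, tangent vectors and values of plane curves are all
   elements of Coquelicot's C, that is, pairs of reals (x, y) = x + i y. *)

Inductive axis : Set := ax1 | ax2.

Definition coord (i : axis) (v : C) : R :=
  match i with ax1 => fst v | ax2 => snd v end.

Definition sum_axis (F : axis -> R) : R := F ax1 + F ax2.

Definition punctured (q : C) : Prop := q <> RtoC 0.

Definition polar (r theta : R) : C := (r * cos theta, r * sin theta).

Definition slice (i : axis) (f : C -> R) (q : C) : R -> R :=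
  match i with
  | ax1 => fun x => f (x, snd q)
  | ax2 => fun y => f (fst q, y)
  end.

Definition partial (i : axis) (f : C -> R) (q : C) : R :=
  Derive (slice i f q) (coord i q).

Fixpoint Ck_on (k : nat) (U : C -> Prop) (f : C -> R) : Prop :=
  match k with
  | O => forall q, U q -> continuous f q
  | S m =>
      (forall q i, U q -> ex_derive (slice i f q) (coord i q)) /\
      (forall i, Ck_on m U (partial i f))
  end.

Definition smooth_map (U : C -> Prop) (Phi : C -> C) : Prop :=
  forall k i, Ck_on k U (fun q => coord i (Phi q)).

Definition differential (Phi : C -> C) (q v : C) : C :=
  (sum_axis (fun i => partial i (fun p => fst (Phi p)) q * coord i v),
   sum_axis (fun i => partial i (fun p => snd (Phi p)) q * coord i v)).

(* [g q v w] is the inner product at q of v and w; the line element is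
   ds^2 (v) = g q v v, and the metrics below are its polarizations. *)
Definition metric := C -> C -> C -> R.

Definition dot (v w : C) : R := fst v * fst w + snd v * snd w.

Definition jm_metric (alpha : R) : metric :=
  fun q v w => dot v w / Rpower (Cmod q) alpha.

(* The differentials of the polar coordinates, in Cartesian components:
   r dr = x dx + y dy and r^2 dtheta = x dy - y dx. *)
Definition d_radius (q v : C) : R := dot q v / Cmod q.

Definition d_angle (q v : C) : R :=
  (fst q * snd v - snd q * fst v) / Cmod q ^ 2.

Definition cone_metric (c : R) : metric :=
  fun q v w => d_radius q v * d_radius q w
               + c ^ 2 * Cmod q ^ 2 * (d_angle q v * d_angle q w).

Definition homothety (k : R) (g1 g2 : metric) (Phi : C -> C) : Prop :=
  smooth_map punctured Phi /\
  (forall q, punctured q -> punctured (Phi q)) /\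
  (exists Psi : C -> C,
     smooth_map punctured Psi /\
     (forall q, punctured q -> punctured (Psi q)) /\
     (forall q, punctured q -> Psi (Phi q) = q) /\
     (forall q, punctured q -> Phi (Psi q) = q)) /\
  (forall q v w, punctured q ->
     g2 (Phi q) (differential Phi q v) (differential Phi q w) = k * g1 q v w).

Definition isometry : metric -> metric -> (C -> C) -> Prop := homothety 1.

(* The cone of angle beta, without its vertex, is the half-plane
   {(rho, phi) | rho > 0} with metric d rho^2 + rho^2 d phi^2, modulo
   phi ~ phi + beta.  The map P exhibits the punctured plane with the metric g
   as this Riemannian quotient. *)
Definition half_plane (p : C) : Prop := 0 < fst p.

Definition cone_cover_metric : metric :=
  fun p v w => fst v * fst w + fst p ^ 2 * (snd v * snd w).

Definition is_cone_of_angle (beta : R) (g : metric) : Prop :=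
  0 < beta /\
  exists P : C -> C,
    smooth_map half_plane P /\
    (forall p, half_plane p -> punctured (P p)) /\
    (forall q, punctured q -> exists p, half_plane p /\ P p = q) /\
    (forall p p', half_plane p -> half_plane p' ->
       (P p = P p' <->
        fst p = fst p' /\ exists k : Z, snd p' = snd p + IZR k * beta)) /\
    (forall p v w, half_plane p ->
       g (P p) (differential P p v) (differential P p w)
       = cone_cover_metric p v w).

Definition basis (i : axis) : C :=
  match i with ax1 => (1, 0) | ax2 => (0, 1) end.

Definition gram (g : metric) (i j : axis) (q : C) : R := g q (basis i) (basis j).

Definition gram_inv (g : metric) (i j : axis) (q : C) : R :=
  let det := gram g ax1 ax1 q * gram g ax2 ax2 q
             - gram g ax1 ax2 q * gram g ax2 ax1 q in
  match i, j with
  | ax1, ax1 => gram g ax2 ax2 q / det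
  | ax2, ax2 => gram g ax1 ax1 q / det
  | ax1, ax2 => - gram g ax1 ax2 q / det
  | ax2, ax1 => - gram g ax2 ax1 q / det
  end.

Definition christoffel (g : metric) (k i j : axis) (q : C) : R :=
  / 2 * sum_axis (fun l =>
    gram_inv g k l q *
    (partial i (gram g j l) q + partial j (gram g i l) q
     - partial l (gram g i j) q)).

Definition open_interval (I : R -> Prop) : Prop :=
  open I /\ (exists t, I t) /\
  (forall s t u, I s -> I u -> s <= t <= u -> I t).

(* A curve is a total function R -> C of which only the values on an open
   interval I matter. *)
Definition velocity (gamma : R -> C) (t : R) : C :=
  (Derive (fun s => fst (gamma s)) t, Derive (fun s => snd (gamma s)) t).

Definition acceleration (gamma : R -> C) : R -> C := velocity (velocity gamma).

Definition twice_derivable_on (I : R -> Prop) (gamma : R -> C) : Prop :=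
  forall t i, I t ->
    ex_derive (fun s => coord i (gamma s)) t /\
    ex_derive (fun s => coord i (velocity gamma s)) t.

(* Constant curves are not counted as geodesics. *)
Definition geodesic (g : metric) (I : R -> Prop) (gamma : R -> C) : Prop :=
  open_interval I /\
  (forall t, I t -> punctured (gamma t)) /\
  twice_derivable_on I gamma /\
  (exists s t, I s /\ I t /\ gamma s <> gamma t) /\
  (forall t k, I t ->
     coord k (acceleration gamma t)
     + sum_axis (fun i => sum_axis (fun j =>
         christoffel g k i j (gamma t)
         * coord i (velocity gamma t) * coord j (velocity gamma t))) = 0).

Definition zero_energy_solution (alpha mu : R) (I : R -> Prop) (q : R -> C)
  : Prop :=
  open_interval I /\
  (forall t, I t -> punctured (q t)) /\
  twice_derivable_on I q /\
  (forall t, I t ->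
     acceleration q t
     = (RtoC (- (mu * alpha) / Rpower (Cmod (q t)) (alpha + 2)) * q t)%C) /\
  (forall t, I t ->
     / 2 * Cmod (velocity q t) ^ 2 - mu / Rpower (Cmod (q t)) alpha = 0).

(* delta = gamma o h for a C^1 diffeomorphism h from J onto I; orientation may
   be reversed. *)
Definition reparameterization (I : R -> Prop) (gamma : R -> C)
    (J : R -> Prop) (delta : R -> C) : Prop :=
  exists h : R -> R,
    (forall s, J s -> I (h s)) /\
    (forall t, I t -> exists s, J s /\ h s = t) /\
    (forall s s', J s -> J s' -> h s = h s' -> s = s') /\
    (forall s, J s ->
       ex_derive h s /\ continuous (Derive h) s /\ Derive h s <> 0) /\
    (forall s, J s -> delta s = gamma (h s)).

(* In the next two definitions, psi is a continuous choice of the polar angle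
   of Q along the curve.  Hence ln |Q| + i psi is a branch of log Q along Q,
   and q is the continuation along Q of one of the values
   exp (a * (ln |Q| + i psi)) of Q^a. *)
Definition power_image (a : R) (I : R -> Prop) (Q q : R -> C) : Prop :=
  exists psi : R -> R,
    forall t, I t ->
      continuous psi t /\
      Q t <> RtoC 0 /\
      Q t = polar (Cmod (Q t)) (psi t) /\
      q t = polar (Rpower (Cmod (Q t)) a) (a * psi t).

(* z is an image of Q under (rho, psi) |-> (rho, theta) = (rho, psi / c). *)
Definition folds (c : R) (I : R -> Prop) (Q z : R -> C) : Prop :=
  exists psi : R -> R,
    forall t, I t ->
      continuous psi t /\
      Q t <> RtoC 0 /\
      Q t = polar (Cmod (Q t)) (psi t) /\
      z t = polar (Cmod (Q t)) (psi t / c).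

(* A curve z on the cone, unfolded to a curve Q of the folding plane, has the
   image q under Q |-> Q^(1/c). *)
Definition cone_power_image (c : R) (I : R -> Prop) (z q : R -> C) : Prop :=
  exists Q : R -> C, folds c I Q z /\ power_image (/ c) I Q q.

Definition line (A B : C) : R -> C := fun t => (A + RtoC t * B)%C.

(* I is all of R if the line misses the origin, and otherwise one of the two
   open half-lines on which the line avoids the origin. *)
Definition line_domain (A B : C) (I : R -> Prop) : Prop :=
  ((forall t, line A B t <> RtoC 0) /\ (forall t, I t)) \/
  (exists t0, line A B t0 = RtoC 0 /\
     ((forall t, I t <-> t < t0) \/ (forall t, I t <-> t0 < t))).

(* Main.v *)
From Stdlib Require Import Reals ZArith Lra Psatz ClassicalEpsilon Ranalysis5.
From Coquelicot Require Import Coquelicot.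
Require Import Defs.
Open Scope R_scope.

(** Encode a plane curve gamma without zeros by its logarithmic velocity, the
    complex function s + i w with gamma' = (s + i w) gamma.  Then s is the
    derivative of ln |gamma| and w that of the polar angle.  Every equation in
    the theorem is invariant under rotations and compatible with dilations, so
    each becomes an autonomous quadratic system for (s, w) in which gamma no
    longer occurs:
    - geodesics of the Jacobi-Maupertuis metric: s' + i w' = - c (s + i w)^2
      ([geodesic_jm_iff]);
    - geodesics of the cone: s' = c^2 w^2 - s^2 and w' = - 2 s w
      ([geodesic_cone_iff]);
    - straight lines: s' + i w' = - (s + i w)^2 ([line_flat_flow]);
    - zero energy solutions: s' = w^2 - s^2 - (alpha / 2) (s^2 + w^2) and
      w' = - 2 s w, together with |q'|^2 = 2 mu |q|^(- alpha)
      ([zero_energy_iff]).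

    For part A, a change of time with dt/du = k |gamma|^e adds e s (s + i w) to
    the right-hand side of such a system ([log_flow_time_change]).  The exponent
    e = - alpha turns the geodesic system into the zero energy system and
    e = alpha does the reverse; the constant speed of a geodesic says which k
    produces energy 0.

    For part C, the map Q |-> Q^(1/c) divides s + i w by c, while the folding map
    divides only w by c ([log_velocity_polar]).  These substitutions carry the
    flat system to the Jacobi-Maupertuis system and to the cone system, and part
    A finishes the argument.  The choice of a branch is harmless because every
    continuous branch of the angle is differentiable with derivative w
    ([angle_is_derive]).

    For part B, the map (r, theta) |-> (k r^c, theta) pulls the cone metric back
    to k^2 c^2 |dq|^2 / |q|^alpha ([radial_homothety]): k = 1 / |c| gives the
    isometry and k = 1 the homothety.  The cone angle is read off from polar
    coordinates with rescaled angle ([cone_angle]). *)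

(** * Terms and their partial derivatives *)

Lemma punctured_Cmod (q : C) : punctured q -> 0 < Cmod q.
Proof. intros H; apply Cmod_gt_0; exact H. Qed.

Lemma Cmod_sqr (q : C) : Cmod q ^ 2 = fst q ^ 2 + snd q ^ 2.
Proof. unfold Cmod; rewrite pow2_sqrt; [reflexivity | nra]. Qed.

Lemma punctured_sumsq (q : C) : punctured q -> 0 < fst q ^ 2 + snd q ^ 2.
Proof. intros H; rewrite <- Cmod_sqr; apply pow_lt, punctured_Cmod, H. Qed.

Lemma Rpower_sub2 (r s : R) : 0 < r -> Rpower r (s - 2) = Rpower r s / r ^ 2.
Proof.
  intros Hr; unfold Rminus; rewrite Rpower_plus, Rpower_Ropp.
  change 2 with (INR 2); rewrite Rpower_pow by exact Hr; reflexivity.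
Qed.

Lemma Rpower_opp2 (r : R) : 0 < r -> Rpower r (- 2) = / r ^ 2.
Proof.
  intros Hr; change (-2) with (Ropp (INR 2)).
  rewrite Rpower_Ropp, Rpower_pow by exact Hr; reflexivity.
Qed.

Lemma is_derive_Rpower_Cmod (x y : R -> R) (t dx dy s : R) :
  punctured (x t, y t) -> is_derive x t dx -> is_derive y t dy ->
  is_derive (fun u => Rpower (Cmod (x u, y u)) s) t
    (s * Rpower (Cmod (x t, y t)) (s - 2) * (x t * dx + y t * dy)).
Proof.
  intros Hq Hx Hy.
  pose proof (punctured_sumsq _ Hq) as H0; pose proof (punctured_Cmod _ Hq) as H1.
  rewrite Rpower_sub2, Cmod_sqr by exact H1.
  cbn [fst snd] in *.
  unfold Rpower, Cmod in *; cbn [fst snd] in *.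
  auto_derive.
  - repeat split; try (eexists; eassumption); assumption || nra.
  - rewrite (is_derive_unique (fun u : R => x u) t dx Hx : Derive (fun u : R => x u) t = dx).
    rewrite (is_derive_unique (fun u : R => y u) t dy Hy : Derive (fun u : R => y u) t = dy).
    replace (x t * (x t * 1) + y t * (y t * 1)) with (x t ^ 2 + y t ^ 2) by ring.
    set (S := sqrt _) in *.
    assert (HS : x t ^ 2 + y t ^ 2 = S * S) by (unfold S; rewrite sqrt_sqrt; lra).
    rewrite HS; field; lra.
Qed.

(** The functions whose partial derivatives are needed: components and Gram
    coefficients of the maps and metrics at hand.  They form an algebra that is
    closed under both partial derivatives, and reifying it lets [dterm] compute
    these derivatives and gives smoothness by one induction.  The trigonometric
    generators serve for polar coordinates, where the second component of a point
    is an angle. *)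
Inductive term : Set :=
  | Const (a : R)
  | Coord (i : axis)
  | RadiusPow (s : R)
  | CosY (k : R)
  | SinY (k : R)
  | Plus (e1 e2 : term)
  | Times (e1 e2 : term).

Fixpoint eval (e : term) (q : C) : R :=
  match e with
  | Const a => a
  | Coord i => coord i q
  | RadiusPow s => Rpower (Cmod q) s
  | CosY k => cos (k * snd q)
  | SinY k => sin (k * snd q)
  | Plus e1 e2 => eval e1 q + eval e2 q
  | Times e1 e2 => eval e1 q * eval e2 q
  end.

Definition delta (i j : axis) : R :=
  match i, j with ax1, ax1 | ax2, ax2 => 1 | _, _ => 0 end.

Fixpoint dterm (i : axis) (e : term) : term :=
  match e with
  | Const _ => Const 0
  | Coord j => Const (delta i j)
  | RadiusPow s => Times (Times (Const s) (RadiusPow (s - 2))) (Coord i)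
  | CosY k => Times (Const (- (delta i ax2 * k))) (SinY k)
  | SinY k => Times (Const (delta i ax2 * k)) (CosY k)
  | Plus e1 e2 => Plus (dterm i e1) (dterm i e2)
  | Times e1 e2 => Plus (Times (dterm i e1) e2) (Times e1 (dterm i e2))
  end.

Lemma slice_coord (i : axis) (f : C -> R) (q : C) : slice i f q (coord i q) = f q.
Proof. destruct q, i; reflexivity. Qed.

Lemma is_derive_eval (i : axis) (e : term) (q : C) :
  punctured q ->
  is_derive (slice i (eval e) q) (coord i q) (eval (dterm i e) q).
Proof.
  intros Hq; induction e as [a|j|s|k|k|e1 IH1 e2 IH2|e1 IH1 e2 IH2].
  - destruct i; simpl; auto_derive; trivial.
  - destruct i, j; simpl; auto_derive; trivial.
  - destruct q as [x y], i; cbn [slice coord eval dterm fst snd].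
    + evar_last.
      * apply (is_derive_Rpower_Cmod (fun u => u) (fun _ => y) x 1 0 s Hq);
          auto_derive; trivial.
      * cbn beta; ring.
    + evar_last.
      * apply (is_derive_Rpower_Cmod (fun _ => x) (fun u => u) y 0 1 s Hq);
          auto_derive; trivial.
      * cbn beta; ring.
  - destruct i; simpl; auto_derive; trivial; ring.
  - destruct i; simpl; auto_derive; trivial; ring.
  - destruct i; apply (is_derive_plus (K := R_AbsRing) (V := R_NormedModule));
      assumption.
  - evar_last.
    + destruct i;
        apply (is_derive_mult _ _ _ _ _ IH1 IH2 Rmult_comm).
    + rewrite !slice_coord; reflexivity.
Qed.

(** A point other than the origin stays so under small displacements along an
    axis, so functions that agree off the origin have the same partial
    derivatives there. *)
Lemma slice_locally_eq (i : axis) (f g : C -> R) (q : C) :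
  (forall p, punctured p -> f p = g p) -> punctured q ->
  locally (coord i q) (fun u => slice i f q u = slice i g q u).
Proof.
  intros Hfg Hq; destruct q as [x y].
  assert (Hne : forall u v : R, u <> 0 \/ v <> 0 -> f (u, v) = g (u, v)).
  { intros u v Huv; apply Hfg; intros E; injection E; intros; tauto. }
  destruct (Req_dec x 0) as [Hx|Hx], (Req_dec y 0) as [Hy|Hy].
  - exfalso; apply Hq; rewrite Hx, Hy; reflexivity.
  - destruct i; simpl; [apply filter_forall; auto|].
    apply (filter_imp (fun u => u <> 0)); [auto|]; now apply open_neq.
  - destruct i; simpl; [|apply filter_forall; auto].
    apply (filter_imp (fun u => u <> 0)); [auto|]; now apply open_neq.
  - destruct i; simpl; apply filter_forall; auto.
Qed.

Lemma is_derive_slice_eval (i : axis) (e : term) (f : C -> R) (q : C) :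
  (forall p, punctured p -> f p = eval e p) -> punctured q ->
  is_derive (slice i f q) (coord i q) (eval (dterm i e) q).
Proof.
  intros Hf Hq; apply is_derive_ext_loc with (slice i (eval e) q).
  - apply slice_locally_eq; [|exact Hq]; intros p Hp; symmetry; auto.
  - now apply is_derive_eval.
Qed.

Lemma partial_eval (i : axis) (e : term) (f : C -> R) (q : C) :
  (forall p, punctured p -> f p = eval e p) -> punctured q ->
  partial i f q = eval (dterm i e) q.
Proof. intros Hf Hq; now apply is_derive_unique, is_derive_slice_eval. Qed.

Lemma continuous_eval (e : term) (q : C) : punctured q -> continuous (eval e) q.
Proof.
  intros Hq.
  induction e as [a|j|s|k|k|e1 IH1 e2 IH2|e1 IH1 e2 IH2]; simpl.
  - apply continuous_const.
  - destruct q, j; [apply continuous_fst | apply continuous_snd].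
  - apply (continuous_comp Cmod (fun r => Rpower r s)).
    + apply (@filterlim_norm _ C_NormedModule).
    + apply (@ex_derive_continuous R_AbsRing R_NormedModule).
      unfold Rpower; auto_derive; now apply punctured_Cmod.
  - apply (continuous_comp snd (fun y => cos (k * y))).
    + destruct q; apply continuous_snd.
    + apply (@ex_derive_continuous R_AbsRing R_NormedModule); auto_derive; trivial.
  - apply (continuous_comp snd (fun y => sin (k * y))).
    + destruct q; apply continuous_snd.
    + apply (@ex_derive_continuous R_AbsRing R_NormedModule); auto_derive; trivial.
  - now apply (continuous_plus (V := R_NormedModule)).
  - now apply (continuous_mult (K := R_AbsRing)).
Qed.

Lemma continuous_punctured_ext (f g : C -> R) (q : C) :
  (forall p, punctured p -> f p = g p) -> punctured q ->
  continuous g q -> continuous f q.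
Proof.
  intros Hfg Hq Hg; apply continuous_ext_loc with g; [|exact Hg].
  assert (Hc : continuous Cmod q) by apply (@filterlim_norm _ C_NormedModule).
  apply (filter_imp (fun p => 0 < Cmod p)).
  - intros p Hp; symmetry; apply Hfg; now apply Cmod_gt_0.
  - apply (Hc (fun r => 0 < r)), open_gt; now apply punctured_Cmod.
Qed.

(** Each partial derivative again agrees, off the origin, with a term, so the
    induction on the order of differentiability closes. *)
Lemma Ck_on_eval (k : nat) (e : term) (f : C -> R) :
  (forall p, punctured p -> f p = eval e p) -> Ck_on k punctured f.
Proof.
  revert e f; induction k as [|k IH]; simpl; intros e f Hf.
  - intros q Hq; apply continuous_punctured_ext with (eval e); auto.
    now apply continuous_eval.
  - split.
    + intros q i Hq; eexists; now apply is_derive_slice_eval with (e := e).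
    + intros i; apply IH with (dterm i e); intros q Hq; now apply partial_eval.
Qed.

Lemma Ck_on_sub (k : nat) (U V : C -> Prop) (f : C -> R) :
  (forall q, V q -> U q) -> Ck_on k U f -> Ck_on k V f.
Proof.
  intros HVU; revert f; induction k as [|k IH]; simpl; intros f Hf; [auto|].
  split; [intros q i Hq; apply Hf; auto | intros i; apply IH, Hf].
Qed.

(** * Changes of time on an interval *)

Lemma antiderivative (I : R -> Prop) (f : R -> R) :
  open_interval I -> (forall t, I t -> continuous f t) ->
  exists F : R -> R, forall t, I t -> is_derive F t (f t).
Proof.
  intros [Ho [[t0 H0] Hc]] Hf; exists (fun t => RInt f t0 t).
  intros t Ht.
  apply (is_derive_RInt f (fun u => RInt f t0 u) t0 t); [|now apply Hf].
  apply (filter_imp I); [|now apply Ho].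
  intros u Hu; apply (@RInt_correct R_CompleteNormedModule).
  apply (@ex_RInt_continuous R_CompleteNormedModule); intros z Hz; apply Hf.
  unfold Rmin, Rmax in Hz.
  destruct (Rle_dec t0 u); [apply (Hc t0 z u) | apply (Hc u z t0)]; auto.
Qed.

Lemma mean_value (I : R -> Prop) (f df : R -> R) (s t : R) :
  open_interval I -> (forall u, I u -> is_derive f u (df u)) -> I s -> I t ->
  exists u, I u /\ Rmin s t <= u <= Rmax s t /\ f t - f s = df u * (t - s).
Proof.
  intros [_ [_ Hc]] Hf Hs Ht.
  assert (HI : forall u, Rmin s t <= u <= Rmax s t -> I u).
  { intros u Hu; unfold Rmin, Rmax in Hu.
    destruct (Rle_dec s t); [apply (Hc s u t) | apply (Hc t u s)]; auto. }
  destruct (MVT_gen f s t df) as [u [Hu E]].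
  - intros u Hu; apply Hf, HI; lra.
  - intros u Hu; apply continuity_pt_filterlim.
    apply (@ex_derive_continuous R_AbsRing R_NormedModule).
    exists (df u); apply Hf, HI, Hu.
  - exists u; auto.
Qed.

Lemma constant_on_interval (I : R -> Prop) (f : R -> R) (s t : R) :
  open_interval I -> (forall u, I u -> is_derive f u 0) -> I s -> I t ->
  f s = f t.
Proof.
  intros HI Hf Hs Ht.
  destruct (mean_value I f (fun _ => 0) s t) as [u [_ [_ E]]]; auto; lra.
Qed.

Lemma interval_surround (I : R -> Prop) (t eps : R) :
  open_interval I -> I t -> 0 < eps ->
  exists d, 0 < d <= eps /\ forall u, t - d <= u <= t + d -> I u.
Proof.
  intros [Ho _] Ht Heps.
  destruct (Ho t Ht) as [e He].
  exists (Rmin eps (e / 2)).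
  pose proof (cond_pos e) as Hpos.
  pose proof (Rmin_l eps (e / 2)); pose proof (Rmin_r eps (e / 2)).
  split; [split; [apply Rmin_pos|]; lra|].
  intros u Hu; apply He.
  change (Rabs (u - t) < e); apply Rabs_def1; lra.
Qed.

(** Solves h' = f(h): the antiderivative H of 1 / f is strictly increasing, and
    h is its inverse.  The mean value theorem writes a difference quotient of h
    as a value of f at an intermediate point, which gives both the
    differentiability of h and the value of its derivative. *)
Lemma time_change (I : R -> Prop) (f : R -> R) :
  open_interval I -> (forall t, I t -> continuous f t /\ 0 < f t) ->
  exists (J : R -> Prop) (h : R -> R),
    open_interval J /\
    (forall s, J s -> I (h s)) /\
    (forall t, I t -> exists s, J s /\ h s = t) /\
    (forall s s', J s -> J s' -> h s = h s' -> s = s') /\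
    (forall s, J s -> is_derive h s (f (h s))).
Proof.
  intros HI Hf.
  destruct (antiderivative I (fun t => / f t) HI) as [H HH].
  { intros t Ht; destruct (Hf t Ht) as [Hc Hp].
    apply (continuous_comp f Rinv); [exact Hc|].
    apply (@ex_derive_continuous R_AbsRing R_NormedModule).
    auto_derive; lra. }
  assert (Hcont : forall t, I t -> continuity_pt H t).
  { intros t Ht; apply continuity_pt_filterlim.
    apply (@ex_derive_continuous R_AbsRing R_NormedModule).
    eexists; now apply HH. }
  assert (Hmono : forall s t, I s -> I t -> s < t -> H s < H t).
  { intros s t Hs Ht Hst.
    destruct (mean_value I H _ s t HI HH Hs Ht) as [u [Hu [_ E]]].
    pose proof (Rinv_0_lt_compat _ (proj2 (Hf u Hu))); nra. }
  assert (Hinj : forall s t, I s -> I t -> H s = H t -> s = t).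
  { intros s t Hs Ht E; destruct (Rtotal_order s t) as [L|[L|L]]; trivial;
      [pose proof (Hmono s t Hs Ht L) | pose proof (Hmono t s Ht Hs L)]; lra. }
  assert (Hivt : forall a b y, I a -> I b -> a < b -> H a <= y <= H b ->
            exists t, I t /\ a <= t <= b /\ H t = y).
  { intros a b y Ha Hb Hab Hy.
    destruct HI as [_ [_ Hconv]].
    destruct (f_interv_is_interv H a b y Hab Hy) as [t [Ht E]].
    - intros t Ht; apply Hcont, (Hconv a t b); auto.
    - exists t; split; [apply (Hconv a t b); auto | auto]. }
  pose (J := fun s => exists t, I t /\ H t = s).
  pose (h := fun s => epsilon (inhabits 0) (fun t => I t /\ H t = s)).
  assert (Hh : forall s, J s -> I (h s) /\ H (h s) = s).
  { intros s Hs; apply (epsilon_spec (inhabits 0) (fun t => I t /\ H t = s) Hs). }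
  assert (HhH : forall t, I t -> h (H t) = t).
  { intros t Ht; assert (Js : J (H t)) by (exists t; auto).
    destruct (Hh _ Js); now apply Hinj. }
  assert (Hnear : forall s eps, J s -> 0 < eps -> exists eta, 0 < eta /\
            forall s', Rabs (s' - s) < eta -> J s' /\ Rabs (h s' - h s) <= eps).
  { intros s eps Hs Heps; destruct (Hh s Hs) as [Ht E].
    set (t := h s) in *.
    destruct (interval_surround I t eps HI Ht Heps) as [d [Hd HId]].
    assert (I1 : I (t - d)) by (apply HId; lra).
    assert (I2 : I (t + d)) by (apply HId; lra).
    assert (L1 : H (t - d) < H t) by (apply Hmono; auto; lra).
    assert (L2 : H t < H (t + d)) by (apply Hmono; auto; lra).
    exists (Rmin (H t - H (t - d)) (H (t + d) - H t)); split.
    { apply Rmin_pos; lra. }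
    intros s' Hs'.
    pose proof (Rmin_l (H t - H (t - d)) (H (t + d) - H t)).
    pose proof (Rmin_r (H t - H (t - d)) (H (t + d) - H t)).
    apply Rabs_def2 in Hs'.
    destruct (Hivt (t - d) (t + d) s') as [t' [It' [Bt' Et']]]; auto; try lra.
    split; [exists t'; auto|].
    rewrite <- Et', HhH by exact It'; apply Rabs_le; lra. }
  exists J, h; split; [split; [|split] | split; [|split; [|split]]].
  - intros s Hs; destruct (Hnear s 1 Hs Rlt_0_1) as [eta [Heta Hn]].
    exists (mkposreal eta Heta); intros s' Hs'; apply Hn; exact Hs'.
  - destruct HI as [_ [[t Ht] _]]; exists (H t), t; auto.
  - intros s v u [t1 [I1 E1]] [t2 [I2 E2]] Hv.
    destruct (Rle_lt_or_eq_dec s v (proj1 Hv)) as [Lv|Ev].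
    2: { subst v; exists t1; auto. }
    assert (t1 < t2).
    { destruct (Rtotal_order t1 t2) as [L|[L|L]]; trivial.
      - subst t2; lra.
      - pose proof (Hmono t2 t1 I2 I1 L); lra. }
    destruct (Hivt t1 t2 v) as [t [It [_ Et]]]; auto; try lra.
    exists t; auto.
  - intros s Hs; apply Hh, Hs.
  - intros t Ht; exists (H t); split; [exists t; auto | auto].
  - intros s s' Hs Hs' E; destruct (Hh s Hs) as [_ E1], (Hh s' Hs') as [_ E2].
    rewrite <- E1, <- E2, E; reflexivity.
  - intros s Hs; apply is_derive_Reals; intros eps Heps.
    destruct (Hh s Hs) as [Ht Es].
    destruct (Hf (h s) Ht) as [Cf _].
    destruct (proj1 (filterlim_locally _ _) Cf (mkposreal eps Heps)) as [d Hd].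
    destruct (Hnear s (d / 2) Hs) as [eta [Heta Hn]].
    { pose proof (cond_pos d); lra. }
    exists (mkposreal eta Heta); intros k Hk0 Hk; simpl in Hk.
    destruct (Hn (s + k)) as [Hsk Habs].
    { replace (s + k - s) with k by ring; exact Hk. }
    destruct (Hh (s + k) Hsk) as [Htk Esk].
    destruct (mean_value I H _ (h s) (h (s + k)) HI HH Ht Htk) as [u [Iu [Bu E]]].
    rewrite Esk, Es in E.
    destruct (Hf u Iu) as [_ Pu].
    replace ((h (s + k) - h s) / k) with (f u).
    + apply Hd; change (Rabs (u - h s) < d).
      pose proof (cond_pos d).
      apply Rle_lt_trans with (d / 2); [|lra].
      apply Rabs_le_between in Habs.
      unfold Rmin, Rmax in Bu; destruct (Rle_dec (h s) (h (s + k)));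
        apply Rabs_le; lra.
    + replace (h (s + k) - h s) with (f u * k); [field; exact Hk0|].
      replace k with (/ f u * (h (s + k) - h s)) at 1 by lra.
      field; lra.
Qed.

(** * Logarithmic velocity of a plane curve *)

(** The equation gamma' = (s + i w) gamma.  Along gamma, s is the derivative of
    ln |gamma| and w the derivative of the polar angle. *)
Definition log_velocity (I : R -> Prop) (gamma : R -> C) (s w : R -> R) : Prop :=
  forall t, I t ->
    punctured (gamma t) /\
    forall i, is_derive (fun u => coord i (gamma u)) t
                (coord i ((s t, w t) * gamma t)%C).

(** The logarithmic velocity of gamma solves the autonomous system
    s' = F(s, w), w' = G(s, w). *)
Definition log_flow (F G : R -> R -> R)
    (I : R -> Prop) (gamma : R -> C) (s w : R -> R) : Prop :=
  log_velocity I gamma s w /\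
  forall t, I t ->
    is_derive s t (F (s t) (w t)) /\ is_derive w t (G (s t) (w t)).

Lemma interval_locally (I : R -> Prop) (t : R) :
  open_interval I -> I t -> locally t I.
Proof. intros [Ho _]; apply Ho. Qed.

Lemma velocity_log_velocity (I : R -> Prop) (gamma : R -> C) (s w : R -> R) (t : R) :
  log_velocity I gamma s w -> I t -> velocity gamma t = ((s t, w t) * gamma t)%C.
Proof.
  intros H Ht; destruct (H t Ht) as [_ D].
  apply injective_projections; apply is_derive_unique;
    [apply (D ax1) | apply (D ax2)].
Qed.

Lemma Cmod_sqr_Cmult (q : C) (s w : R) :
  Cmod ((s, w) * q) ^ 2 = (s ^ 2 + w ^ 2) * Cmod q ^ 2.
Proof. rewrite !Cmod_sqr; simpl; ring. Qed.

(** The logarithmic velocity is gamma' / gamma, with real and imaginary parts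
    written out over |gamma|^2. *)
Lemma log_velocity_exists (I : R -> Prop) (gamma : R -> C) :
  (forall t, I t -> punctured (gamma t)) -> twice_derivable_on I gamma ->
  exists s w : R -> R,
    log_velocity I gamma s w /\ forall t, I t -> ex_derive s t /\ ex_derive w t.
Proof.
  intros Hp Hd.
  pose (x := fun t => fst (gamma t)); pose (y := fun t => snd (gamma t)).
  pose (x' := fun t => fst (velocity gamma t)).
  pose (y' := fun t => snd (velocity gamma t)).
  exists (fun t => (x t * x' t + y t * y' t) / (x t ^ 2 + y t ^ 2)),
         (fun t => (x t * y' t - y t * x' t) / (x t ^ 2 + y t ^ 2)).
  assert (Hr : forall t, I t -> x t ^ 2 + y t ^ 2 <> 0).
  { intros t Ht; pose proof (punctured_sumsq _ (Hp t Ht)); unfold x, y; lra. }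
  split.
  - intros t Ht; split; [now apply Hp|].
    intros i; specialize (Hr t Ht).
    destruct (Hd t i Ht) as [D _].
    evar_last; [apply Derive_correct, D|].
    destruct i; cbn [coord fst snd Cmult];
      [change (Derive _ t) with (x' t) | change (Derive _ t) with (y' t)];
      fold (x t) (y t); field; exact Hr.
  - intros t Ht; specialize (Hr t Ht).
    assert (Dx : ex_derive x t) by apply (Hd t ax1 Ht).
    assert (Dy : ex_derive y t) by apply (Hd t ax2 Ht).
    assert (Dx' : ex_derive x' t) by apply (Hd t ax1 Ht).
    assert (Dy' : ex_derive y' t) by apply (Hd t ax2 Ht).
    clearbody x y x' y'.
    split; auto_derive; repeat split; trivial;
      intros E; apply Hr; rewrite <- E; ring.
Qed.

(** The product rule on (s + i w) gamma: the summand (s + i w)^2 comes from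
    differentiating gamma. *)
Lemma velocity_is_derive (I : R -> Prop) (gamma : R -> C) (s w : R -> R)
    (t ds dw : R) (i : axis) :
  open_interval I -> log_velocity I gamma s w -> I t ->
  is_derive s t ds -> is_derive w t dw ->
  is_derive (fun u => coord i (velocity gamma u)) t
    (coord i (((ds + s t ^ 2 - w t ^ 2)%R, (dw + 2 * s t * w t)%R) * gamma t)%C).
Proof.
  intros HI H Ht Ds Dw.
  apply is_derive_ext_loc with (fun u => coord i ((s u, w u) * gamma u)%C).
  { apply (filter_imp I); [|now apply interval_locally].
    intros u Hu; rewrite (velocity_log_velocity I gamma s w u H Hu); reflexivity. }
  destruct (H t Ht) as [_ D].
  pose proof (D ax1) as D1; pose proof (D ax2) as D2; cbn [coord] in D1, D2.
  destruct i; cbn [coord Cmult fst snd] in *.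
  - evar_last.
    + apply (is_derive_minus (K := R_AbsRing) (V := R_NormedModule));
        [apply (is_derive_mult _ _ _ _ _ Ds D1 Rmult_comm)
        | apply (is_derive_mult _ _ _ _ _ Dw D2 Rmult_comm)].
    + unfold minus, plus, opp, mult; simpl; ring.
  - evar_last.
    + apply (is_derive_plus (K := R_AbsRing) (V := R_NormedModule));
        [apply (is_derive_mult _ _ _ _ _ Ds D2 Rmult_comm)
        | apply (is_derive_mult _ _ _ _ _ Dw D1 Rmult_comm)].
    + unfold minus, plus, opp, mult; simpl; ring.
Qed.

Lemma acceleration_log_velocity (I : R -> Prop) (gamma : R -> C) (s w : R -> R)
    (t ds dw : R) :
  open_interval I -> log_velocity I gamma s w -> I t ->
  is_derive s t ds -> is_derive w t dw ->
  acceleration gamma t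
  = (((ds + s t ^ 2 - w t ^ 2)%R, (dw + 2 * s t * w t)%R) * gamma t)%C.
Proof.
  intros HI H Ht Ds Dw.
  apply injective_projections; apply is_derive_unique;
    [apply (velocity_is_derive I gamma s w t ds dw ax1)
    | apply (velocity_is_derive I gamma s w t ds dw ax2)]; assumption.
Qed.

Lemma log_flow_twice_derivable (F G : R -> R -> R)
    (I : R -> Prop) (gamma : R -> C) (s w : R -> R) :
  open_interval I -> log_flow F G I gamma s w -> twice_derivable_on I gamma.
Proof.
  intros HI [H D] t i Ht; split.
  - eexists; now apply H.
  - destruct (D t Ht) as [Ds Dw].
    eexists; now apply (velocity_is_derive I gamma s w t _ _ i HI H Ht Ds Dw).
Qed.

Lemma Cmult_reg (q : C) (a b a' b' : R) :
  punctured q -> ((a, b) * q)%C = ((a', b') * q)%C -> a = a' /\ b = b'.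
Proof.
  intros Hq E; pose proof (punctured_sumsq q Hq) as Hr.
  destruct q as [x y]; injection E as E1 E2; cbn [fst snd] in *.
  split; apply Rmult_eq_reg_r with (x ^ 2 + y ^ 2); try lra.
  - replace (a * (x ^ 2 + y ^ 2)) with ((a * x - b * y) * x + (a * y + b * x) * y) by ring.
    rewrite E1, E2; ring.
  - replace (b * (x ^ 2 + y ^ 2)) with ((a * y + b * x) * x - (a * x - b * y) * y) by ring.
    rewrite E1, E2; ring.
Qed.

(** The derivative vanishes exactly where s + i w does, since gamma has no
    zero. *)
Lemma log_velocity_nonconstant (I : R -> Prop) (gamma : R -> C) (s w : R -> R) :
  open_interval I -> log_velocity I gamma s w ->
  ((exists t u, I t /\ I u /\ gamma t <> gamma u) <->
   (exists t, I t /\ s t ^ 2 + w t ^ 2 <> 0)).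
Proof.
  intros HI H; split.
  - intros [t [u [Ht [Hu Hne]]]]; apply NNPP; intros Hno; apply Hne.
    assert (H0 : forall v i, I v -> is_derive (fun z => coord i (gamma z)) v 0).
    { intros v i Hv; destruct (H v Hv) as [_ D].
      evar_last; [apply D|].
      assert (E : s v ^ 2 + w v ^ 2 = 0) by (apply NNPP; intros E; apply Hno; eauto).
      assert (Es : s v = 0) by nra; assert (Ew : w v = 0) by nra.
      rewrite Es, Ew; destruct i; simpl; ring. }
    apply injective_projections.
    + apply (constant_on_interval I (fun z => fst (gamma z))); auto.
      intros v Hv; apply (H0 v ax1 Hv).
    + apply (constant_on_interval I (fun z => snd (gamma z))); auto.
      intros v Hv; apply (H0 v ax2 Hv).
  - intros [t [Ht Hne]]; apply NNPP; intros Hno.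
    assert (Hc : forall u, I u -> gamma u = gamma t).
    { intros u Hu; apply NNPP; intros E; apply Hno; exists u, t; auto. }
    assert (D0 : forall i, is_derive (fun z => coord i (gamma z)) t 0).
    { intros i; apply is_derive_ext_loc with (fun _ => coord i (gamma t)).
      - apply (filter_imp I); [|now apply interval_locally].
        intros u Hu; now rewrite (Hc u Hu).
      - apply (is_derive_const (K := R_AbsRing) (V := R_NormedModule)). }
    destruct (H t Ht) as [Hp D].
    destruct (Cmult_reg (gamma t) (s t) (w t) 0 0 Hp) as [E1 E2].
    + assert (Ei : forall i, coord i ((s t, w t) * gamma t)%C = 0).
      { intros i; rewrite <- (is_derive_unique _ _ _ (D i)).
        apply is_derive_unique, D0. }
      apply injective_projections;
        [rewrite (Ei ax1 : fst _ = 0) | rewrite (Ei ax2 : snd _ = 0)]; simpl; ring.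
    + apply Hne; rewrite E1, E2; ring.
Qed.

Lemma is_derive_Rpower_log (I : R -> Prop) (gamma : R -> C) (s w : R -> R) (t e : R) :
  log_velocity I gamma s w -> I t ->
  is_derive (fun u => Rpower (Cmod (gamma u)) e) t
    (e * s t * Rpower (Cmod (gamma t)) e).
Proof.
  intros H Ht; destruct (H t Ht) as [Hp D].
  assert (Hp' : punctured (fst (gamma t), snd (gamma t)))
    by (rewrite <- surjective_pairing; exact Hp).
  evar_last.
  - apply (is_derive_Rpower_Cmod (fun u => fst (gamma u)) (fun u => snd (gamma u))
             t _ _ e Hp' (D ax1) (D ax2)).
  - cbn beta; rewrite <- surjective_pairing.
    pose proof (punctured_Cmod _ Hp) as Hr.
    rewrite Rpower_sub2 by exact Hr.
    assert (E := Cmod_sqr (gamma t)).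
    assert (E0 : 0 < Cmod (gamma t) ^ 2) by (apply pow_lt, Hr).
    cbn [coord Cmult fst snd].
    rewrite E in *; field; lra.
Qed.

Definition homogeneous2 (F : R -> R -> R) : Prop :=
  forall k s w, F (k * s) (k * w) = k ^ 2 * F s w.

(** The new time u with dt/du = f = k |gamma|^e multiplies s + i w by f, and
    df/du = e s f^2 because s is the derivative of ln |gamma|.  Hence the factor
    f^2 comes out of a quadratic system, and what is left over is the extra term
    e s (s + i w). *)
Lemma log_flow_time_change (F G : R -> R -> R) (e k : R)
    (I : R -> Prop) (gamma : R -> C) (s w : R -> R) :
  open_interval I -> 0 < k -> homogeneous2 F -> homogeneous2 G ->
  log_flow F G I gamma s w ->
  let f := fun t => k * Rpower (Cmod (gamma t)) e in
  exists (J : R -> Prop) (h : R -> R),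
    open_interval J /\
    (forall u, J u -> I (h u)) /\
    reparameterization I gamma J (fun u => gamma (h u)) /\
    log_flow (fun a b => F a b + e * a ^ 2) (fun a b => G a b + e * a * b)
      J (fun u => gamma (h u))
      (fun u => f (h u) * s (h u)) (fun u => f (h u) * w (h u)).
Proof.
  intros HI Hk HF HG [H D] f.
  assert (Df : forall t, I t -> is_derive f t (e * s t * f t)).
  { intros t Ht; evar_last.
    - apply (is_derive_scal _ t k), (is_derive_Rpower_log I gamma s w t e H Ht).
    - unfold f, scal; simpl; unfold mult; simpl; ring. }
  assert (Cf : forall t, I t -> continuous f t).
  { intros t Ht; apply (@ex_derive_continuous R_AbsRing R_NormedModule).
    eexists; now apply Df. }
  assert (Pf : forall t, 0 < f t).
  { intros t; apply Rmult_lt_0_compat; [exact Hk | apply exp_pos]. }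
  destruct (time_change I f HI) as [J [h [HJ [HJI [Hsurj [Hinj Dh]]]]]].
  { intros t Ht; auto. }
  exists J, h; split; [exact HJ|]; split; [exact HJI|].
  assert (Dfh : forall u, J u ->
            is_derive (fun v => f (h v)) u (e * s (h u) * f (h u) * f (h u))).
  { intros u Hu; evar_last.
    - apply (is_derive_comp f h u _ _ (Df _ (HJI u Hu)) (Dh u Hu)).
    - unfold scal; simpl; unfold mult; simpl; ring. }
  split.
  - exists h; split; [exact HJI|]; split; [exact Hsurj|]; split; [exact Hinj|].
    split; [|reflexivity].
    intros u Hu; split; [eexists; now apply Dh|]; split.
    + apply continuous_ext_loc with (fun v => f (h v)).
      * apply (filter_imp J); [|now apply interval_locally].
        intros v Hv; symmetry; apply is_derive_unique, Dh, Hv.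
      * apply (@ex_derive_continuous R_AbsRing R_NormedModule).
        eexists; now apply Dfh.
    + rewrite (is_derive_unique _ _ _ (Dh u Hu)); apply Rgt_not_eq, Pf.
  - split.
    + intros u Hu; destruct (H (h u) (HJI u Hu)) as [Hp Dg]; split; [exact Hp|].
      intros i; evar_last.
      * apply (is_derive_comp (fun v => coord i (gamma v)) h u _ _ (Dg i) (Dh u Hu)).
      * unfold scal; simpl; unfold mult; simpl.
        destruct i; simpl; ring.
    + intros u Hu; destruct (D (h u) (HJI u Hu)) as [Ds Dw].
      split; evar_last.
      * apply (is_derive_mult _ _ _ _ _ (Dfh u Hu)
                 (is_derive_comp s h u _ _ Ds (Dh u Hu)) Rmult_comm).
      * rewrite HF; unfold scal, plus, mult; simpl; unfold mult; simpl; ring.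
      * apply (is_derive_mult _ _ _ _ _ (Dfh u Hu)
                 (is_derive_comp w h u _ _ Dw (Dh u Hu)) Rmult_comm).
      * rewrite HG; unfold scal, plus, mult; simpl; unfold mult; simpl; ring.
Qed.

(** * Polar angle along a curve *)

Lemma Cmod_polar (r theta : R) : 0 < r -> Cmod (polar r theta) = r.
Proof.
  intros Hr; apply Rsqr_inj; [apply Cmod_ge_0 | lra|].
  rewrite !Rsqr_pow2, Cmod_sqr; unfold polar; cbn [fst snd].
  pose proof (sin2_cos2 theta) as E; rewrite !Rsqr_pow2 in E.
  replace ((r * cos theta) ^ 2 + (r * sin theta) ^ 2)
    with (r ^ 2 * (sin theta ^ 2 + cos theta ^ 2)) by ring.
  rewrite E; ring.
Qed.

Lemma punctured_polar (r theta : R) : 0 < r -> punctured (polar r theta).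
Proof.
  intros Hr E; pose proof (Cmod_polar r theta Hr) as H.
  rewrite E, Cmod_0 in H; lra.
Qed.

(** The angle is acos (x / |q|), up to the sign, which is that of y. *)
Lemma polar_exists (q : C) : punctured q -> exists theta, q = polar (Cmod q) theta.
Proof.
  intros Hq; pose proof (punctured_Cmod q Hq) as Hr.
  pose proof (Cmod_sqr q) as E; destruct q as [x y]; cbn [fst snd] in E.
  set (r := Cmod (x, y)) in *.
  assert (Hx : -1 <= x / r <= 1).
  { split; apply Rmult_le_reg_r with r; try exact Hr;
      unfold Rdiv; rewrite Rmult_assoc, Rinv_l by lra; nra. }
  assert (Hs : sin (acos (x / r)) = Rabs y / r).
  { rewrite sin_acos by exact Hx.
    replace (1 - (x / r)²) with ((y / r)²).
    - rewrite sqrt_Rsqr_abs; unfold Rdiv; rewrite Rabs_mult.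
      rewrite (Rabs_pos_eq (/ r)); [reflexivity|].
      apply Rlt_le, Rinv_0_lt_compat, Hr.
    - unfold Rsqr; field_simplify; [|lra|lra].
      rewrite E; f_equal; ring. }
  destruct (Rle_dec 0 y) as [Hy|Hy].
  - exists (acos (x / r)); unfold polar.
    rewrite cos_acos, Hs, Rabs_pos_eq by assumption.
    f_equal; field; lra.
  - exists (- acos (x / r)); unfold polar.
    rewrite cos_neg, sin_neg, cos_acos, Hs, Rabs_left by (assumption || lra).
    f_equal; field; lra.
Qed.

(** Raising the modulus to the power a and multiplying the angle by b turns
    d(ln rho) + i dpsi into a d(ln rho) + i b dpsi.  The case a = b is the power
    map, the case a = 1 the folding map. *)
Lemma log_velocity_polar (I : R -> Prop) (Q q : R -> C) (s w psi : R -> R) (a b : R) :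
  open_interval I -> log_velocity I Q s w ->
  (forall t, I t -> is_derive psi t (w t)) ->
  (forall t, I t -> q t = polar (Rpower (Cmod (Q t)) a) (b * psi t)) ->
  log_velocity I q (fun t => a * s t) (fun t => b * w t).
Proof.
  intros HI H Hpsi Hq t Ht.
  split.
  { rewrite (Hq t Ht); apply punctured_polar, exp_pos. }
  pose proof (is_derive_Rpower_log I Q s w t a H Ht) as Dr.
  assert (Dc : is_derive (fun u => cos (b * psi u)) t (- (b * w t) * sin (b * psi t))).
  { auto_derive; [eexists; now apply Hpsi|].
    rewrite (is_derive_unique (fun u : R => psi u) t _ (Hpsi t Ht)
             : Derive (fun u : R => psi u) t = _); ring. }
  assert (Ds : is_derive (fun u => sin (b * psi u)) t ((b * w t) * cos (b * psi t))).
  { auto_derive; [eexists; now apply Hpsi|].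
    rewrite (is_derive_unique (fun u : R => psi u) t _ (Hpsi t Ht)
             : Derive (fun u : R => psi u) t = _); ring. }
  intros i; apply is_derive_ext_loc with
    (fun u => coord i (polar (Rpower (Cmod (Q u)) a) (b * psi u))).
  { apply (filter_imp I); [|now apply interval_locally].
    intros u Hu; now rewrite (Hq u Hu). }
  rewrite (Hq t Ht).
  destruct i; cbn [coord polar fst snd Cmult]; evar_last.
  - apply (is_derive_mult _ _ _ _ _ Dr Dc Rmult_comm).
  - unfold plus, mult; simpl; ring.
  - apply (is_derive_mult _ _ _ _ _ Dr Ds Rmult_comm).
  - unfold plus, mult; simpl; ring.
Qed.

(** Continuity of a branch of the angle suffices for its differentiability: near
    t the increment of psi is below PI / 2, so it is the arctangent of a quotient
    of the cross and dot products of Q t and Q u. *)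
Lemma angle_is_derive (I : R -> Prop) (Q : R -> C) (s w psi : R -> R) :
  open_interval I -> log_velocity I Q s w ->
  (forall t, I t -> continuous psi t /\ Q t = polar (Cmod (Q t)) (psi t)) ->
  forall t, I t -> is_derive psi t (w t).
Proof.
  intros HI H Hpsi t Ht.
  pose (x := fun u => fst (Q u)); pose (y := fun u => snd (Q u)).
  apply is_derive_ext_loc with (fun u => psi t +
    atan ((x t * y u - y t * x u) / (x t * x u + y t * y u))).
  - destruct (Hpsi t Ht) as [Hc Et].
    assert (Hnear : locally t (fun u => Rabs (psi u - psi t) < PI / 2)).
    { assert (HP : 0 < PI / 2) by (pose proof PI_RGT_0; lra).
      apply (proj1 (filterlim_locally _ _) Hc (mkposreal _ HP)). }
    generalize (filter_and _ _ Hnear (interval_locally I t HI Ht)).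
    apply filter_imp; intros u [Hu Iu].
    destruct (Hpsi u Iu) as [_ Eu].
    destruct (H t Ht) as [Pt _], (H u Iu) as [Pu _].
    apply punctured_Cmod in Pt; apply punctured_Cmod in Pu.
    apply Rabs_def2 in Hu.
    unfold x, y; rewrite Et, Eu; unfold polar; cbn [fst snd].
    assert (Hcos : 0 < cos (psi u - psi t)) by (apply cos_gt_0; lra).
    rewrite cos_minus in Hcos.
    match goal with |- _ + atan ?X = _ => replace X with (tan (psi u - psi t)) end.
    + rewrite atan_tan by lra; apply Rplus_minus.
    + unfold tan; rewrite sin_minus, cos_minus.
      set (ru := Cmod (Q u)) in *; set (rt := Cmod (Q t)) in *.
      replace (rt * cos (psi t) * (ru * cos (psi u)) + rt * sin (psi t) * (ru * sin (psi u)))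
        with (rt * ru * (cos (psi u) * cos (psi t) + sin (psi u) * sin (psi t))) by ring.
      field; repeat split; lra.
  - destruct (H t Ht) as [Pt D].
    pose proof (punctured_sumsq _ Pt) as Hr.
    pose proof (D ax1 : is_derive x t (s t * x t - w t * y t)) as Dx.
    pose proof (D ax2 : is_derive y t (s t * y t + w t * x t)) as Dy.
    fold (x t) (y t) in Hr; clearbody x y.
    auto_derive.
    + repeat split; try (eexists; eassumption); nra.
    + rewrite (is_derive_unique (fun u : R => x u) t _ Dx : Derive (fun u : R => x u) t = _).
      rewrite (is_derive_unique (fun u : R => y u) t _ Dy : Derive (fun u : R => y u) t = _).
      replace (x t * y t + - (y t * x t)) with 0 by ring.
      field; nra.
Qed.

(** Take an antiderivative psi of w with the right value at one point.  The
    curve Z of modulus 1 / |Q| and angle - psi has the opposite logarithmic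
    velocity, so that the product Z Q is constant, hence equal to 1. *)
Lemma angle_exists (I : R -> Prop) (Q : R -> C) (s w : R -> R) :
  open_interval I -> log_velocity I Q s w -> (forall t, I t -> continuous w t) ->
  exists psi : R -> R,
    forall t, I t -> continuous psi t /\ Q t = polar (Cmod (Q t)) (psi t).
Proof.
  intros HI H Hw.
  destruct (antiderivative I w HI Hw) as [phi Dphi].
  assert (HI' := HI); destruct HI' as [_ [[t0 H0] _]].
  destruct (polar_exists (Q t0) (proj1 (H t0 H0))) as [th E0].
  pose (psi := fun t => phi t + (th - phi t0)).
  assert (Dpsi : forall t, I t -> is_derive psi t (w t)).
  { intros t Ht; evar_last.
    - apply (is_derive_plus phi (fun _ => th - phi t0) t (w t) 0);
        [now apply Dphi | apply (is_derive_const (K := R_AbsRing) (V := R_NormedModule))].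
    - unfold plus; simpl; ring. }
  pose (Z := fun t => polar (Rpower (Cmod (Q t)) (-1)) ((-1) * psi t)).
  assert (HZ : log_velocity I Z (fun t => -1 * s t) (fun t => -1 * w t)).
  { apply (log_velocity_polar I Q Z s w psi); auto. }
  assert (HZQ : forall t, I t -> (Z t * Q t)%C = (Z t0 * Q t0)%C).
  { intros t Ht; apply injective_projections.
    - apply (constant_on_interval I (fun u => fst (Z u * Q u)%C)); auto.
      intros u Hu; destruct (HZ u Hu) as [_ DZ], (H u Hu) as [_ DQ].
      cbn [Cmult fst]; evar_last.
      + apply (is_derive_minus (K := R_AbsRing) (V := R_NormedModule));
        [apply (is_derive_mult _ _ _ _ _ (DZ ax1) (DQ ax1) Rmult_comm)
        | apply (is_derive_mult _ _ _ _ _ (DZ ax2) (DQ ax2) Rmult_comm)].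
      + unfold minus, plus, opp, mult; simpl; ring.
    - apply (constant_on_interval I (fun u => snd (Z u * Q u)%C)); auto.
      intros u Hu; destruct (HZ u Hu) as [_ DZ], (H u Hu) as [_ DQ].
      cbn [Cmult snd]; evar_last.
      + apply (is_derive_plus (K := R_AbsRing) (V := R_NormedModule));
        [apply (is_derive_mult _ _ _ _ _ (DZ ax1) (DQ ax2) Rmult_comm)
        | apply (is_derive_mult _ _ _ _ _ (DZ ax2) (DQ ax1) Rmult_comm)].
      + unfold plus, mult; simpl; ring. }
  assert (HZm : forall t p, punctured (Q t) ->
            ((Z t * polar (Cmod (Q t)) p)%C = (cos (p - psi t), sin (p - psi t)))).
  { intros t p Hp; pose proof (punctured_Cmod _ Hp) as Hr.
    assert (E1 : Rpower (Cmod (Q t)) (-1) * Cmod (Q t) = 1).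
    { change (-1) with (Ropp 1); rewrite Rpower_Ropp, Rpower_1 by exact Hr; field; lra. }
    unfold Z, polar, Cmult; cbn [fst snd].
    replace (-1 * psi t) with (- psi t) by ring.
    rewrite cos_neg, sin_neg, cos_minus, sin_minus; f_equal.
    - replace (Rpower (Cmod (Q t)) (-1) * cos (psi t) * (Cmod (Q t) * cos p) -
         Rpower (Cmod (Q t)) (-1) * - sin (psi t) * (Cmod (Q t) * sin p))
        with (Rpower (Cmod (Q t)) (-1) * Cmod (Q t) *
              (cos p * cos (psi t) + sin p * sin (psi t))) by ring.
      rewrite E1; ring.
    - replace (Rpower (Cmod (Q t)) (-1) * cos (psi t) * (Cmod (Q t) * sin p) +
         Rpower (Cmod (Q t)) (-1) * - sin (psi t) * (Cmod (Q t) * cos p))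
        with (Rpower (Cmod (Q t)) (-1) * Cmod (Q t) *
              (sin p * cos (psi t) - cos p * sin (psi t))) by ring.
      rewrite E1; ring. }
  exists psi; intros t Ht; split.
  - apply (@ex_derive_continuous R_AbsRing R_NormedModule); eexists; now apply Dpsi.
  - destruct (H t Ht) as [Pt _], (H t0 H0) as [P0 _].
    assert (HZt : punctured (Z t)) by (apply (HZ t Ht)).
    assert (E : (Z t * Q t)%C = (Z t * polar (Cmod (Q t)) (psi t))%C).
    { rewrite (HZQ t Ht), E0 at 1; rewrite HZm, HZm by assumption.
      unfold psi; f_equal; f_equal; ring. }
    rewrite 2!(Cmult_comm (Z t)) in E.
    rewrite (surjective_pairing (Q t)) in E at 1.
    destruct (Cmult_reg (Z t) _ _ _ _ HZt E) as [E1 E2].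
    apply injective_projections; assumption.
Qed.

(** * Geodesics and zero energy solutions *)

(** The Jacobi-Maupertuis system s' + i w' = - c (s + i w)^2. *)
Definition jm_flow (c : R) :
    (R -> Prop) -> (R -> C) -> (R -> R) -> (R -> R) -> Prop :=
  log_flow (fun a b => - c * (a ^ 2 - b ^ 2)) (fun a b => - (2 * c) * a * b).

(** The geodesic equations rho'' = c^2 rho theta'^2 and
    rho theta'' = - 2 rho' theta' of the cone, with s = rho' / rho and
    w = theta'. *)
Definition cone_flow (c : R) :
    (R -> Prop) -> (R -> C) -> (R -> R) -> (R -> R) -> Prop :=
  log_flow (fun a b => c ^ 2 * b ^ 2 - a ^ 2) (fun a b => - 2 * a * b).

(** The quadratic part of the geodesic equation. *)
Definition christoffel_quadratic (g : metric) (k : axis) (q v : C) : R :=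
  sum_axis (fun i => sum_axis (fun j =>
    christoffel g k i j q * coord i v * coord j v)).

(** Since gamma'' = (s' + i w' + (s + i w)^2) gamma, the geodesic equation says
    that s' + i w' is a function of (s, w) as soon as the Christoffel term has
    the form (A(s, w) + i B(s, w)) gamma.  It has this form whenever rotations are
    isometries and dilations are homotheties of g, since these maps are linear
    and so preserve the Christoffel symbols. *)
Lemma geodesic_log_flow (g : metric) (F G : R -> R -> R) :
  (forall q s w k, punctured q ->
     christoffel_quadratic g k q ((s, w) * q)%C
     = coord k (Cmult (w ^ 2 - s ^ 2 - F s w, - (2 * s * w) - G s w) q)) ->
  forall (I : R -> Prop) (gamma : R -> C),
  geodesic g I gamma <->
  open_interval I /\
  exists s w : R -> R, log_flow F G I gamma s w /\
    exists t, I t /\ s t ^ 2 + w t ^ 2 <> 0.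
Proof.
  intros Hg I gamma; split.
  - intros [HI [Hp [Hd [Hnc Heq]]]]; split; [exact HI|].
    destruct (log_velocity_exists I gamma Hp Hd) as [s [w [H Hsw]]].
    exists s, w; split; [|now apply (log_velocity_nonconstant I gamma s w HI H)].
    split; [exact H|]; intros t Ht.
    destruct (Hsw t Ht) as [Ds Dw].
    apply Derive_correct in Ds; apply Derive_correct in Dw.
    assert (E : Cmult (Derive s t - F (s t) (w t), Derive w t - G (s t) (w t)) (gamma t)
                = Cmult (0, 0) (gamma t)).
    { assert (Ek : forall k, coord k (Cmult (Derive s t - F (s t) (w t),
                     Derive w t - G (s t) (w t)) (gamma t)) = 0).
      { intros k; rewrite <- (Heq t k Ht).
        change (sum_axis _) with (christoffel_quadratic g k (gamma t) (velocity gamma t)).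
        rewrite (velocity_log_velocity I gamma s w t H Ht), Hg by (now apply Hp).
        rewrite (acceleration_log_velocity I gamma s w t _ _ HI H Ht Ds Dw).
        destruct k; simpl; ring. }
      apply injective_projections;
        [rewrite (Ek ax1 : fst _ = 0) | rewrite (Ek ax2 : snd _ = 0)]; simpl; ring. }
    destruct (Cmult_reg _ _ _ _ _ (Hp t Ht) E) as [E1 E2].
    split; [replace (F (s t) (w t)) with (Derive s t) by lra
           | replace (G (s t) (w t)) with (Derive w t) by lra]; assumption.
  - intros [HI [s [w [HF Hnc]]]]; assert (HF' := HF); destruct HF' as [H D].
    split; [exact HI|]; split; [intros t Ht; now apply H|].
    split; [now apply (log_flow_twice_derivable F G I gamma s w)|].
    split; [now apply (log_velocity_nonconstant I gamma s w HI H)|].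
    intros t k Ht; destruct (D t Ht) as [Ds Dw].
    change (sum_axis _) with (christoffel_quadratic g k (gamma t) (velocity gamma t)).
    rewrite (velocity_log_velocity I gamma s w t H Ht), Hg by (now apply H).
    rewrite (acceleration_log_velocity I gamma s w t _ _ HI H Ht Ds Dw).
    destruct k; simpl; ring.
Qed.

Definition jm_term (alpha : R) (i j : axis) : term :=
  Times (Const (delta i j)) (RadiusPow (- alpha)).

Lemma gram_jm (alpha : R) (i j : axis) (q : C) :
  gram (jm_metric alpha) i j q = eval (jm_term alpha i j) q.
Proof.
  unfold gram, jm_metric, jm_term, dot; cbn [eval].
  rewrite Rpower_Ropp; destruct i, j; simpl; unfold Rdiv; ring.
Qed.

Lemma christoffel_quadratic_jm (alpha c : R) (q : C) (s w : R) (k : axis) :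
  c = 1 - alpha / 2 -> punctured q ->
  christoffel_quadratic (jm_metric alpha) k q ((s, w) * q)%C
  = coord k (Cmult (w ^ 2 - s ^ 2 - - c * (s ^ 2 - w ^ 2),
                    - (2 * s * w) - - (2 * c) * s * w) q).
Proof.
  intros Hc Hq.
  assert (HP : forall l i j, partial l (gram (jm_metric alpha) i j) q
                             = eval (dterm l (jm_term alpha i j)) q).
  { intros l i j; apply partial_eval; [intros p _; apply gram_jm | exact Hq]. }
  pose proof (punctured_Cmod q Hq) as Hr; pose proof (Cmod_sqr q) as E.
  pose proof (punctured_sumsq q Hq) as H0.
  assert (HL : 0 < Rpower (Cmod q) (- alpha)) by apply exp_pos.
  unfold christoffel_quadratic, sum_axis, christoffel, gram_inv, sum_axis.
  rewrite !HP, !gram_jm; unfold jm_term; cbn [dterm eval delta].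
  rewrite Rpower_sub2, E by exact Hr.
  set (L := Rpower _ _) in *; clearbody L.
  destruct q as [x y]; cbn [coord fst snd Cmult] in *; subst c.
  destruct k; cbn [coord fst snd Cmult]; field; repeat split; nra.
Qed.

Definition cone_term (c : R) (i j : axis) : term :=
  Plus (Const (c ^ 2 * delta i j))
    (Times (Const (1 - c ^ 2)) (Times (Times (Coord i) (Coord j)) (RadiusPow (- 2)))).

Lemma gram_cone (c : R) (i j : axis) (q : C) :
  punctured q -> gram (cone_metric c) i j q = eval (cone_term c i j) q.
Proof.
  intros Hq; pose proof (punctured_Cmod q Hq) as Hr; pose proof (Cmod_sqr q) as E.
  pose proof (punctured_sumsq q Hq) as H0.
  unfold gram, cone_metric, cone_term, d_radius, d_angle; cbn [eval].
  rewrite Rpower_opp2 by exact Hr.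
  replace (dot q (basis i) / Cmod q * (dot q (basis j) / Cmod q))
    with (dot q (basis i) * dot q (basis j) / Cmod q ^ 2) by (field; lra).
  rewrite E; destruct q as [x y]; cbn [fst snd] in *.
  unfold dot; destruct i, j; cbn [basis fst snd coord delta]; field; lra.
Qed.

Lemma christoffel_quadratic_cone (c : R) (q : C) (s w : R) (k : axis) :
  c <> 0 -> punctured q ->
  christoffel_quadratic (cone_metric c) k q ((s, w) * q)%C
  = coord k (Cmult (w ^ 2 - s ^ 2 - (c ^ 2 * w ^ 2 - s ^ 2),
                    - (2 * s * w) - - 2 * s * w) q).
Proof.
  intros Hc Hq.
  assert (HP : forall l i j, partial l (gram (cone_metric c) i j) q
                             = eval (dterm l (cone_term c i j)) q).
  { intros l i j; apply partial_eval; [intros p Hp; now apply gram_cone | exact Hq]. }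
  pose proof (punctured_Cmod q Hq) as Hr; pose proof (Cmod_sqr q) as E.
  pose proof (punctured_sumsq q Hq) as H0.
  unfold christoffel_quadratic, sum_axis, christoffel, gram_inv, sum_axis.
  rewrite !HP, !gram_cone by exact Hq; unfold cone_term; cbn [dterm eval delta].
  rewrite Rpower_sub2, Rpower_opp2, E by exact Hr.
  destruct q as [x y]; cbn [coord fst snd Cmult] in *.
  (* Up to the factor (x^2 + y^2)^2 this is the Gram determinant, which is c^2. *)
  assert (Hdet : (c ^ 2 * (x ^ 2 + y ^ 2) + (1 - c ^ 2) * (x * x)) *
                 (c ^ 2 * (x ^ 2 + y ^ 2) + (1 - c ^ 2) * (y * y)) -
                 (1 - c ^ 2) * (x * y) * ((1 - c ^ 2) * (y * x)) <> 0).
  { replace (_ - _) with (c ^ 2 * (x ^ 2 + y ^ 2) ^ 2) by ring.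
    apply Rmult_integral_contrapositive_currified; apply pow_nonzero; lra. }
  destruct k; cbn [coord fst snd Cmult]; field; (split; [lra | exact Hdet]).
Qed.

(** In complex notation the geodesic equation is
    gamma'' = (alpha / 2) gamma'^2 / gamma. *)
Lemma geodesic_jm_iff (alpha c : R) (I : R -> Prop) (gamma : R -> C) :
  c = 1 - alpha / 2 ->
  (geodesic (jm_metric alpha) I gamma <->
   open_interval I /\
   exists s w : R -> R,
     jm_flow c I gamma s w /\
     exists t, I t /\ s t ^ 2 + w t ^ 2 <> 0).
Proof.
  intros Hc; apply geodesic_log_flow; intros q s w k Hq.
  now apply christoffel_quadratic_jm.
Qed.

Lemma geodesic_cone_iff (c : R) (I : R -> Prop) (z : R -> C) :
  c <> 0 ->
  (geodesic (cone_metric c) I z <->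
   open_interval I /\
   exists s w : R -> R,
     cone_flow c I z s w /\
     exists t, I t /\ s t ^ 2 + w t ^ 2 <> 0).
Proof.
  intros Hc; apply geodesic_log_flow; intros q s w k Hq.
  now apply christoffel_quadratic_cone.
Qed.

(** As |q'|^2 = (s^2 + w^2) |q|^2, zero energy lets the coefficient
    - mu alpha / |q|^(alpha + 2) of the force be replaced by
    - (alpha / 2) (s^2 + w^2), which makes the system autonomous. *)
Lemma zero_energy_iff (alpha mu : R) (I : R -> Prop) (q : R -> C) :
  zero_energy_solution alpha mu I q <->
  open_interval I /\
  exists s w : R -> R,
    log_flow (fun a b => b ^ 2 - a ^ 2 - alpha / 2 * (a ^ 2 + b ^ 2))
             (fun a b => - 2 * a * b) I q s w /\
    forall t, I t ->
      (s t ^ 2 + w t ^ 2) * Cmod (q t) ^ 2 = 2 * mu * Rpower (Cmod (q t)) (- alpha).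
Proof.
  assert (Hforce : forall p, punctured p -> forall n,
            n * Cmod p ^ 2 = 2 * mu * Rpower (Cmod p) (- alpha) ->
            - (mu * alpha) / Rpower (Cmod p) (alpha + 2) = - (alpha / 2 * n)).
  { intros p Hp n E; pose proof (punctured_Cmod p Hp) as Hr.
    assert (E2 : Rpower (Cmod p) 2 = Cmod p ^ 2) by (apply (Rpower_pow 2), Hr).
    rewrite Rpower_Ropp in E; rewrite Rpower_plus, E2.
    assert (HL : 0 < Rpower (Cmod p) alpha) by apply exp_pos.
    assert (Hr2 : 0 < Cmod p ^ 2) by (apply pow_lt, Hr).
    replace n with (n * Cmod p ^ 2 / Cmod p ^ 2) by (field; lra).
    rewrite E; field; lra. }
  split.
  - intros [HI [Hp [Hd [Hacc Hen]]]]; split; [exact HI|].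
    destruct (log_velocity_exists I q Hp Hd) as [s [w [H Hsw]]].
    assert (Hspeed : forall t, I t ->
       (s t ^ 2 + w t ^ 2) * Cmod (q t) ^ 2 = 2 * mu * Rpower (Cmod (q t)) (- alpha)).
    { intros t Ht; specialize (Hen t Ht).
      rewrite (velocity_log_velocity I q s w t H Ht), Cmod_sqr_Cmult in Hen.
      rewrite Rpower_Ropp; unfold Rdiv in Hen; lra. }
    exists s, w; split; [|exact Hspeed].
    split; [exact H|]; intros t Ht.
    destruct (Hsw t Ht) as [Ds Dw].
    apply Derive_correct in Ds; apply Derive_correct in Dw.
    specialize (Hacc t Ht).
    rewrite (acceleration_log_velocity I q s w t _ _ HI H Ht Ds Dw) in Hacc.
    rewrite (Hforce _ (Hp t Ht) _ (Hspeed t Ht)) in Hacc.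
    unfold RtoC in Hacc.
    destruct (Cmult_reg _ _ _ _ _ (Hp t Ht) Hacc) as [E1 E2].
    split.
    + replace (_ - _) with (Derive s t) by lra; exact Ds.
    + replace (_ * _ * _) with (Derive w t) by lra; exact Dw.
  - intros [HI [s [w [HF Hspeed]]]]; assert (HF' := HF); destruct HF' as [H D].
    split; [exact HI|]; split; [intros t Ht; now apply H|].
    split; [now apply (log_flow_twice_derivable _ _ I q s w HI HF)|].
    split; intros t Ht; destruct (H t Ht) as [Hp _].
    + destruct (D t Ht) as [Ds Dw].
      rewrite (acceleration_log_velocity I q s w t _ _ HI H Ht Ds Dw).
      rewrite (Hforce _ Hp _ (Hspeed t Ht)); unfold RtoC.
      f_equal; f_equal; field.
    + rewrite (velocity_log_velocity I q s w t H Ht), Cmod_sqr_Cmult.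
      rewrite (Hspeed t Ht), Rpower_Ropp; unfold Rdiv; lra.
Qed.

(** This is the conservation of the squared Riemannian speed
    |gamma'|^2 / |gamma|^alpha, as 2 c = 2 - alpha. *)
Lemma jm_speed_constant (c : R) (I : R -> Prop) (gamma : R -> C) (s w : R -> R) (t u : R) :
  open_interval I ->
  jm_flow c I gamma s w ->
  I t -> I u ->
  (s t ^ 2 + w t ^ 2) * Rpower (Cmod (gamma t)) (2 * c)
  = (s u ^ 2 + w u ^ 2) * Rpower (Cmod (gamma u)) (2 * c).
Proof.
  intros HI [H D] Ht Hu.
  apply (constant_on_interval I
    (fun v => (s v ^ 2 + w v ^ 2) * Rpower (Cmod (gamma v)) (2 * c))); auto.
  intros v Hv; destruct (D v Hv) as [Ds Dw].
  assert (Dn : is_derive (fun z => s z ^ 2 + w z ^ 2) v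
    (2 * s v * (- c * (s v ^ 2 - w v ^ 2)) + 2 * w v * (- (2 * c) * s v * w v))).
  { auto_derive; [split; [|split; trivial]; eexists; eassumption|].
    rewrite (is_derive_unique (fun z : R => s z) v _ Ds : Derive (fun z : R => s z) v = _).
    rewrite (is_derive_unique (fun z : R => w z) v _ Dw : Derive (fun z : R => w z) v = _).
    ring. }
  evar_last.
  - apply (is_derive_mult _ _ _ _ _ Dn
             (is_derive_Rpower_log I gamma s w v (2 * c) H Hv) Rmult_comm).
  - unfold plus, mult; simpl; ring.
Qed.

(** The time change with e = - alpha carries the geodesic system to the zero
    energy system; its constant k is fixed by the constant speed of the
    geodesic, so that the energy is 0. *)
Lemma geodesic_to_zero_energy (alpha mu : R) (I : R -> Prop) (gamma : R -> C) :
  0 < mu -> geodesic (jm_metric alpha) I gamma ->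
  exists (J : R -> Prop) (q : R -> C),
    zero_energy_solution alpha mu J q /\ reparameterization I gamma J q.
Proof.
  intros Hmu Hg.
  pose (c := 1 - alpha / 2).
  apply (geodesic_jm_iff alpha c I gamma eq_refl) in Hg.
  destruct Hg as [HI [s [w [HF [t0 [H0 Hne]]]]]].
  (* K is the squared Riemannian speed of gamma, the same at all times. *)
  pose (K := (s t0 ^ 2 + w t0 ^ 2) * Rpower (Cmod (gamma t0)) (2 * c)).
  assert (HK : 0 < K) by (apply Rmult_lt_0_compat; [nra | apply exp_pos]).
  assert (Hk2 : 0 < 2 * mu / K) by (apply Rdiv_lt_0_compat; lra).
  assert (HhF : homogeneous2 (fun a b => - c * (a ^ 2 - b ^ 2)))
    by (intros k a b; ring).
  assert (HhG : homogeneous2 (fun a b => - (2 * c) * a * b))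
    by (intros k a b; ring).
  destruct (log_flow_time_change _ _ (- alpha) (sqrt (2 * mu / K)) I gamma s w HI
              (sqrt_lt_R0 _ Hk2) HhF HhG HF) as [J [h [HJ [HJI [Hrep HF']]]]].
  exists J, (fun u => gamma (h u)); split; [|exact Hrep].
  apply zero_energy_iff; split; [exact HJ|].
  eexists; eexists; split.
  - destruct HF' as [H D]; split; [exact H|].
    intros u Hu; destruct (D u Hu) as [Ds Dw]; cbn beta in *.
    split; evar_last; [exact Ds | | exact Dw |]; unfold c; field.
  - intros u Hu; cbn beta.
    assert (Hp : punctured (gamma (h u))) by (apply HF, HJI, Hu).
    apply punctured_Cmod in Hp.
    pose proof (jm_speed_constant c I gamma s w (h u) t0 HI HF (HJI u Hu) H0) as E.
    fold K in E.
    assert (EP : Rpower (Cmod (gamma (h u))) (2 * c)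
                 = Cmod (gamma (h u)) ^ 2 * Rpower (Cmod (gamma (h u))) (- alpha)).
    { replace (2 * c) with (2 + - alpha) by (unfold c; field).
      rewrite Rpower_plus; f_equal; apply (Rpower_pow 2), Hp. }
    rewrite EP in E.
    set (L := Rpower _ (- alpha)) in *; set (r := Cmod (gamma (h u))) in *.
    transitivity
      (sqrt (2 * mu / K) ^ 2 * L * ((s (h u) ^ 2 + w (h u) ^ 2) * (r ^ 2 * L))); [ring|].
    rewrite E, pow2_sqrt by lra; field; lra.
Qed.

(** The inverse time change, e = alpha, makes the speed constant. *)
Lemma zero_energy_to_geodesic (alpha mu : R) (J : R -> Prop) (q : R -> C) :
  0 < mu -> zero_energy_solution alpha mu J q ->
  exists (I : R -> Prop) (gamma : R -> C),
    geodesic (jm_metric alpha) I gamma /\ reparameterization J q I gamma.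
Proof.
  intros Hmu Hq; apply zero_energy_iff in Hq.
  destruct Hq as [HJ [s [w [HF Hspeed]]]].
  assert (HhF : homogeneous2 (fun a b => b ^ 2 - a ^ 2 - alpha / 2 * (a ^ 2 + b ^ 2)))
    by (intros k a b; field).
  assert (HhG : homogeneous2 (fun a b => - 2 * a * b)) by (intros k a b; ring).
  destruct (log_flow_time_change _ _ alpha 1 J q s w HJ Rlt_0_1 HhF HhG HF)
    as [I [h [HI [HIJ [Hrep HF']]]]].
  exists I, (fun u => q (h u)); split; [|exact Hrep].
  apply (geodesic_jm_iff alpha (1 - alpha / 2) _ _ eq_refl); split; [exact HI|].
  eexists; eexists; split.
  - destruct HF' as [H D]; split; [exact H|].
    intros u Hu; destruct (D u Hu) as [Ds Dw]; cbn beta in *.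
    split; evar_last; [exact Ds | | exact Dw |]; field.
  - destruct HI as [_ [[u Hu] _]]; exists u; split; [exact Hu|]; cbn beta.
    specialize (Hspeed (h u) (HIJ u Hu)).
    assert (HL : 0 < Rpower (Cmod (q (h u))) (- alpha)) by apply exp_pos.
    assert (HM : 0 < Rpower (Cmod (q (h u))) alpha) by apply exp_pos.
    set (L := Rpower _ (- alpha)) in *; set (M := Rpower _ alpha) in *.
    intros E0.
    assert (En : s (h u) ^ 2 + w (h u) ^ 2 = 0).
    { apply Rmult_eq_reg_l with (M ^ 2); [|nra].
      rewrite Rmult_0_r, <- E0; ring. }
    rewrite En in Hspeed; nra.
Qed.

(** * Lines, folding and powers *)

(** The system s' + i w' = - (s + i w)^2, that is, vanishing acceleration. *)
Definition flat_flow : (R -> Prop) -> (R -> C) -> (R -> R) -> (R -> R) -> Prop :=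
  log_flow (fun a b => b ^ 2 - a ^ 2) (fun a b => - 2 * a * b).

(** A line with nonzero direction passes through the origin at most once. *)
Lemma line_domain_interval (A B : C) (I : R -> Prop) :
  B <> RtoC 0 -> line_domain A B I ->
  open_interval I /\ forall t, I t -> punctured (line A B t).
Proof.
  intros HB HL.
  assert (Hinj : forall t t0, line A B t0 = RtoC 0 -> t <> t0 ->
            punctured (line A B t)).
  { intros t t0 E0 Hne E; apply HB.
    assert (E1 : (RtoC (t - t0) * B = RtoC 0)%C).
    { transitivity (line A B t - line A B t0)%C; [|rewrite E, E0; ring].
      unfold line; rewrite RtoC_minus; ring. }
    assert (Hne' : RtoC (t - t0) <> RtoC 0).
    { intros E2; injection E2 as E2; lra. }
    transitivity (/ RtoC (t - t0) * (RtoC (t - t0) * B))%C; [field; exact Hne'|].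
    rewrite E1; ring. }
  destruct HL as [[Hp Hall] | [t0 [E0 [HI | HI]]]].
  - split; [|intros t _; apply Hp].
    split; [intros t _; apply filter_forall; exact Hall|].
    split; [exists 0; apply Hall | intros; apply Hall].
  - split.
    + split.
      * apply open_ext with (fun t => t < t0); [|apply open_lt].
        intros t; split; apply HI.
      * split; [exists (t0 - 1); apply HI; lra|].
        intros a b d _ Hd Hb; apply HI in Hd; apply HI; lra.
    + intros t Ht; apply HI in Ht; apply (Hinj t t0); [exact E0 | lra].
  - split.
    + split.
      * apply open_ext with (fun t => t0 < t); [|apply open_gt].
        intros t; split; apply HI.
      * split; [exists (t0 + 1); apply HI; lra|].
        intros a b d Ha _ Hb; apply HI in Ha; apply HI; lra.
    + intros t Ht; apply HI in Ht; apply (Hinj t t0); [exact E0 | lra].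
Qed.

Lemma line_flat_flow (A B : C) (I : R -> Prop) :
  B <> RtoC 0 -> open_interval I -> (forall t, I t -> punctured (line A B t)) ->
  exists s w : R -> R, flat_flow I (line A B) s w /\
    exists t, I t /\ s t ^ 2 + w t ^ 2 <> 0.
Proof.
  intros HB HI Hp.
  assert (Dl : forall t i, is_derive (fun u => coord i (line A B u)) t (coord i B)).
  { intros t i; destruct i; simpl; auto_derive; trivial; ring. }
  assert (Hv : forall t, velocity (line A B) t = B).
  { intros t; apply injective_projections; apply is_derive_unique;
      [apply (Dl t ax1) | apply (Dl t ax2)]. }
  assert (Dv : forall t i, is_derive (fun u => coord i (velocity (line A B) u)) t 0).
  { intros t i; apply is_derive_ext with (fun _ => coord i B).
    - intros u; now rewrite Hv.
    - apply (is_derive_const (K := R_AbsRing) (V := R_NormedModule)). }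
  assert (Ha : forall t, acceleration (line A B) t = RtoC 0).
  { intros t; apply injective_projections; apply is_derive_unique;
      [apply (Dv t ax1) | apply (Dv t ax2)]. }
  destruct (log_velocity_exists I (line A B) Hp) as [s [w [H Hsw]]].
  { intros t i _; split; eexists; [apply Dl | apply Dv]. }
  exists s, w; split; [split; [exact H|]|].
  - intros t Ht; destruct (Hsw t Ht) as [Ds Dw].
    apply Derive_correct in Ds; apply Derive_correct in Dw.
    pose proof (acceleration_log_velocity I _ s w t _ _ HI H Ht Ds Dw) as E.
    rewrite Ha in E.
    replace (RtoC 0) with (Cmult (0, 0) (line A B t)) in E
      by (apply injective_projections; simpl; ring).
    destruct (Cmult_reg _ _ _ _ _ (Hp t Ht) E) as [E1 E2].
    split; [replace (_ - _) with (Derive s t) by lra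
           | replace (_ * _ * _) with (Derive w t) by lra]; assumption.
  - assert (HI' := HI); destruct HI' as [_ [[t Ht] _]]; exists t; split; [exact Ht|].
    intros E; apply HB.
    pose proof (Cmod_sqr_Cmult (line A B t) (s t) (w t)) as E2.
    rewrite <- (velocity_log_velocity I _ s w t H Ht), Hv, E in E2.
    apply Cmod_eq_0; nra.
Qed.

(** If s + i w solves the flat system, then (s + i w) / c solves the
    Jacobi-Maupertuis system: a multiple by 1 / c absorbs the factor c of a
    quadratic right-hand side. *)
Lemma power_image_jm_flow (c : R) (I : R -> Prop) (Q q : R -> C) (s w : R -> R) :
  c <> 0 -> open_interval I -> flat_flow I Q s w -> power_image (/ c) I Q q ->
  jm_flow c I q (fun t => / c * s t) (fun t => / c * w t).
Proof.
  intros Hc HI [H D] [psi Hpsi]; split.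
  - apply (log_velocity_polar I Q q s w psi); [exact HI | exact H | |].
    + apply (angle_is_derive I Q s w psi HI H).
      intros t Ht; destruct (Hpsi t Ht) as [Cp [_ [Ep _]]]; auto.
    + intros t Ht; apply Hpsi, Ht.
  - intros t Ht; destruct (D t Ht) as [Ds Dw]; split; evar_last.
    + apply (is_derive_scal _ t (/ c) _ Ds).
    + unfold scal; simpl; unfold mult; simpl; field; exact Hc.
    + apply (is_derive_scal _ t (/ c) _ Dw).
    + unfold scal; simpl; unfold mult; simpl; field; exact Hc.
Qed.

Lemma power_image_zero_energy (alpha mu c : R) (I : R -> Prop) (Q q : R -> C)
    (s w : R -> R) :
  0 < mu -> c = 1 - alpha / 2 -> c <> 0 -> open_interval I -> flat_flow I Q s w ->
  (exists t, I t /\ s t ^ 2 + w t ^ 2 <> 0) -> power_image (/ c) I Q q ->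
  exists (J : R -> Prop) (p : R -> C),
    zero_energy_solution alpha mu J p /\ reparameterization I q J p.
Proof.
  intros Hmu Hca Hc HI HQ [t [Ht Hne]] Hq.
  apply geodesic_to_zero_energy; [exact Hmu|].
  apply (geodesic_jm_iff alpha c I q Hca); split; [exact HI|].
  eexists; eexists; split; [apply (power_image_jm_flow c I Q q s w); assumption|].
  exists t; split; [exact Ht|]; cbn beta; intros E; apply Hne.
  apply Rmult_eq_reg_l with ((/ c) ^ 2).
  - rewrite Rmult_0_r, <- E; ring.
  - apply pow_nonzero, Rinv_neq_0_compat, Hc.
Qed.

Lemma polar_Rpower_1 (q : C) (theta : R) :
  punctured q -> polar (Rpower (Cmod q) 1) theta = polar (Cmod q) theta.
Proof. intros Hq; rewrite Rpower_1; [reflexivity | now apply punctured_Cmod]. Qed.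

(** The folding map divides w by c and keeps s; putting w = c (w / c) in the
    flat system gives the cone system. *)
Lemma folds_cone_flow (c : R) (I : R -> Prop) (Q z : R -> C) (s w : R -> R) :
  c <> 0 -> open_interval I -> flat_flow I Q s w -> folds c I Q z ->
  cone_flow c I z (fun t => 1 * s t) (fun t => / c * w t).
Proof.
  intros Hc HI [H D] [psi Hpsi]; split.
  - apply (log_velocity_polar I Q z s w psi); [exact HI | exact H | |].
    + apply (angle_is_derive I Q s w psi HI H).
      intros t Ht; destruct (Hpsi t Ht) as [Cp [_ [Ep _]]]; auto.
    + intros t Ht; destruct (Hpsi t Ht) as [_ [Hp [_ Ez]]].
      rewrite polar_Rpower_1, Ez by exact Hp; f_equal; field; exact Hc.
  - intros t Ht; destruct (D t Ht) as [Ds Dw]; split; evar_last.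
    + apply (is_derive_scal _ t 1 _ Ds).
    + unfold scal; simpl; unfold mult; simpl; field; exact Hc.
    + apply (is_derive_scal _ t (/ c) _ Dw).
    + unfold scal; simpl; unfold mult; simpl; field; exact Hc.
Qed.

(** Here psi / c is a continuous angle along z, hence differentiable, although
    nothing is known of the regularity of Q. *)
Lemma unfolded_flat_flow (c : R) (I : R -> Prop) (Q z : R -> C) (s w : R -> R) :
  c <> 0 -> open_interval I ->
  cone_flow c I z s w ->
  folds c I Q z ->
  flat_flow I Q (fun t => 1 * s t) (fun t => c * w t).
Proof.
  intros Hc HI [H D] [psi Hpsi].
  assert (Hmod : forall t, I t -> Cmod (z t) = Cmod (Q t)).
  { intros t Ht; destruct (Hpsi t Ht) as [_ [Hp [_ Ez]]].
    rewrite Ez; apply Cmod_polar, punctured_Cmod, Hp. }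
  split.
  - apply (log_velocity_polar I z Q s w (fun t => psi t / c)); [exact HI | exact H | |].
    + apply (angle_is_derive I z s w _ HI H).
      intros t Ht; destruct (Hpsi t Ht) as [Cp [_ [_ Ez]]]; split.
      * apply (continuous_mult (K := R_AbsRing) psi (fun _ => / c)); [exact Cp|].
        apply continuous_const.
      * rewrite Hmod by exact Ht; exact Ez.
    + intros t Ht; destruct (Hpsi t Ht) as [_ [_ [EQ _]]].
      rewrite polar_Rpower_1, Hmod by (exact Ht || apply H, Ht).
      replace (c * (psi t / c)) with (psi t) by (field; exact Hc); exact EQ.
  - intros t Ht; destruct (D t Ht) as [Ds Dw]; split; evar_last.
    + apply (is_derive_scal _ t 1 _ Ds).
    + unfold scal; simpl; unfold mult; simpl; ring.
    + apply (is_derive_scal _ t c _ Dw).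
    + unfold scal; simpl; unfold mult; simpl; ring.
Qed.

Lemma log_flow_angle (F G : R -> R -> R) (I : R -> Prop) (Q : R -> C) (s w : R -> R) :
  open_interval I -> log_flow F G I Q s w ->
  exists psi : R -> R,
    forall t, I t -> continuous psi t /\ Q t = polar (Cmod (Q t)) (psi t).
Proof.
  intros HI [H D]; apply (angle_exists I Q s w HI H).
  intros t Ht; apply (@ex_derive_continuous R_AbsRing R_NormedModule).
  eexists; apply D, Ht.
Qed.

Lemma power_image_exists (a : R) (I : R -> Prop) (Q : R -> C) (psi : R -> R) :
  (forall t, I t -> punctured (Q t)) ->
  (forall t, I t -> continuous psi t /\ Q t = polar (Cmod (Q t)) (psi t)) ->
  exists q : R -> C, power_image a I Q q.
Proof.
  intros Hp Hpsi.
  exists (fun t => polar (Rpower (Cmod (Q t)) a) (a * psi t)), psi.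
  intros t Ht; destruct (Hpsi t Ht); repeat split; auto; now apply Hp.
Qed.

(** A continuous angle theta along z gives the unfolded curve, of angle
    c theta, whose power then has angle theta again. *)
Lemma cone_power_image_exists (c : R) (I : R -> Prop) (z : R -> C) (theta : R -> R) :
  c <> 0 -> (forall t, I t -> punctured (z t)) ->
  (forall t, I t -> continuous theta t /\ z t = polar (Cmod (z t)) (theta t)) ->
  exists q : R -> C, cone_power_image c I z q.
Proof.
  intros Hc Hp Htheta.
  pose (Q := fun t => polar (Cmod (z t)) (c * theta t)).
  assert (HQ : forall t, I t -> punctured (Q t) /\ Cmod (Q t) = Cmod (z t)).
  { intros t Ht; pose proof (punctured_Cmod _ (Hp t Ht)).
    split; [now apply punctured_polar | now apply Cmod_polar]. }
  assert (Hpsi : forall t, I t -> continuous (fun u => c * theta u) t /\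
            Q t = polar (Cmod (Q t)) (c * theta t)).
  { intros t Ht; destruct (Htheta t Ht) as [Ct _]; split.
    - apply (continuous_mult (K := R_AbsRing) (fun _ => c) theta); [|exact Ct].
      apply continuous_const.
    - destruct (HQ t Ht) as [_ E]; rewrite E; reflexivity. }
  destruct (power_image_exists (/ c) I Q _ (fun t Ht => proj1 (HQ t Ht)) Hpsi)
    as [q Hq].
  exists q, Q; split; [|exact Hq].
  exists (fun t => c * theta t); intros t Ht.
  destruct (Hpsi t Ht) as [Ct EQ], (HQ t Ht) as [PQ Em], (Htheta t Ht) as [_ Ez].
  repeat split; auto.
  rewrite Em; replace (c * theta t / c) with (theta t) by (field; exact Hc); exact Ez.
Qed.

(** * Radial maps and the cone angle *)

(** The map (r, theta) |-> (k r^(1 + e), theta), written without the angle so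
    that its components are terms. *)
Definition radial_map (k e : R) (q : C) : C :=
  (k * Rpower (Cmod q) e * fst q, k * Rpower (Cmod q) e * snd q).

Definition radial_term (k e : R) (i : axis) : term :=
  Times (Times (Const k) (RadiusPow e)) (Coord i).

Lemma coord_radial_map (k e : R) (i : axis) (q : C) :
  coord i (radial_map k e q) = eval (radial_term k e i) q.
Proof. destruct i; reflexivity. Qed.

Lemma smooth_radial_map (k e : R) : smooth_map punctured (radial_map k e).
Proof.
  intros n i; apply Ck_on_eval with (radial_term k e i).
  intros p _; apply coord_radial_map.
Qed.

Lemma radial_map_polar (k e r theta : R) :
  0 < r -> radial_map k e (polar r theta) = polar (k * Rpower r (1 + e)) theta.
Proof.
  intros Hr; unfold radial_map; rewrite Cmod_polar by exact Hr.
  rewrite Rpower_plus, Rpower_1 by exact Hr.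
  unfold polar; cbn [fst snd]; f_equal; ring.
Qed.

Lemma punctured_radial_map (k e : R) (q : C) :
  0 < k -> punctured q -> punctured (radial_map k e q).
Proof.
  intros Hk Hq; destruct (polar_exists q Hq) as [theta E].
  rewrite E, radial_map_polar by (now apply punctured_Cmod).
  apply punctured_polar, Rmult_lt_0_compat; [exact Hk | apply exp_pos].
Qed.

Lemma radial_map_inverse (k e k' e' : R) (q : C) :
  0 < k -> (1 + e) * (1 + e') = 1 -> k' * Rpower k (1 + e') = 1 -> punctured q ->
  radial_map k' e' (radial_map k e q) = q.
Proof.
  intros Hk He Hk' Hq; destruct (polar_exists q Hq) as [theta E].
  pose proof (punctured_Cmod q Hq) as Hr.
  assert (HP : 0 < Rpower (Cmod q) (1 + e)) by apply exp_pos.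
  rewrite E at 1; rewrite radial_map_polar by exact Hr.
  rewrite radial_map_polar by (now apply Rmult_lt_0_compat).
  rewrite <- Rpower_mult_distr by assumption.
  rewrite Rpower_mult, He, Rpower_1 by exact Hr.
  rewrite <- Rmult_assoc, Hk', Rmult_1_l; symmetry; exact E.
Qed.

Lemma differential_radial_map (k e : R) (q v : C) :
  punctured q ->
  differential (radial_map k e) q v
  = (k * Rpower (Cmod q) e * (fst v + e * dot q v / Cmod q ^ 2 * fst q),
     k * Rpower (Cmod q) e * (snd v + e * dot q v / Cmod q ^ 2 * snd q)).
Proof.
  intros Hq; pose proof (punctured_Cmod q Hq) as Hr.
  unfold differential, sum_axis.
  rewrite !(partial_eval _ (radial_term k e ax1) (fun p => fst (radial_map k e p)))
    by (trivial; intros p _; apply (coord_radial_map k e ax1)).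
  rewrite !(partial_eval _ (radial_term k e ax2) (fun p => snd (radial_map k e p)))
    by (trivial; intros p _; apply (coord_radial_map k e ax2)).
  unfold radial_term; cbn [dterm eval delta].
  rewrite Rpower_sub2 by exact Hr; unfold dot; cbn [coord].
  f_equal; field; lra.
Qed.

Lemma Cmod_radial_map (k e : R) (q : C) :
  0 < k -> punctured q ->
  Cmod (radial_map k e q) = k * Rpower (Cmod q) e * Cmod q.
Proof.
  intros Hk Hq; destruct (polar_exists q Hq) as [theta E].
  pose proof (punctured_Cmod q Hq) as Hr.
  rewrite E at 1; rewrite radial_map_polar by exact Hr.
  rewrite Cmod_polar by (apply Rmult_lt_0_compat; [exact Hk | apply exp_pos]).
  rewrite Rpower_plus, Rpower_1 by exact Hr; ring.
Qed.

Lemma d_radius_radial_map (k e : R) (q v : C) :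
  0 < k -> punctured q ->
  d_radius (radial_map k e q) (differential (radial_map k e) q v)
  = k * Rpower (Cmod q) e * (1 + e) * d_radius q v.
Proof.
  intros Hk Hq; unfold d_radius.
  rewrite Cmod_radial_map, differential_radial_map by assumption.
  unfold radial_map, dot; cbn [fst snd].
  pose proof (Cmod_sqr q) as E; pose proof (punctured_Cmod q Hq) as Hr.
  assert (HL : 0 < Rpower (Cmod q) e) by apply exp_pos.
  set (L := Rpower (Cmod q) e) in *; set (r := Cmod q) in *.
  transitivity (k * L * (1 + e * ((fst q ^ 2 + snd q ^ 2) / r ^ 2))
                * (fst q * fst v + snd q * snd v) / r); [field; lra|].
  rewrite <- E; field; lra.
Qed.

Lemma d_angle_radial_map (k e : R) (q v : C) :
  0 < k -> punctured q ->
  d_angle (radial_map k e q) (differential (radial_map k e) q v) = d_angle q v.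
Proof.
  intros Hk Hq; unfold d_angle.
  rewrite Cmod_radial_map, differential_radial_map by assumption.
  unfold radial_map; cbn [fst snd].
  pose proof (punctured_Cmod q Hq) as Hr.
  assert (HL : 0 < Rpower (Cmod q) e) by apply exp_pos.
  field; lra.
Qed.

(** With rho = k r^c the form d rho pulls back to k c r^(c - 1) dr, and d theta
    to itself, so the cone metric pulls back to
    k^2 c^2 r^(2 c - 2) (dr^2 + r^2 dtheta^2), where 2 c - 2 = - alpha. *)
Lemma radial_homothety (alpha c k : R) :
  c = 1 - alpha / 2 -> c <> 0 -> 0 < k ->
  homothety (k ^ 2 * c ^ 2) (jm_metric alpha) (cone_metric c) (radial_map k (c - 1)).
Proof.
  intros Hca Hc Hk.
  split; [apply smooth_radial_map|].
  split; [intros q; now apply punctured_radial_map|].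
  split.
  (* The inverse takes the modulus rho to (rho / k)^(1 / c). *)
  - pose (k' := Rpower k (- / c)).
    assert (Hk' : 0 < k') by apply exp_pos.
    exists (radial_map k' (/ c - 1)).
    split; [apply smooth_radial_map|].
    split; [intros q; now apply punctured_radial_map|].
    split; intros q Hq; apply radial_map_inverse; trivial.
    + field; exact Hc.
    + unfold k'; rewrite <- Rpower_plus.
      replace (_ + _) with 0 by ring; now apply Rpower_O.
    + field; exact Hc.
    + unfold k'; rewrite Rpower_mult.
      replace (- / c * (1 + (c - 1))) with (Ropp 1) by (field; exact Hc).
      rewrite Rpower_Ropp, Rpower_1 by exact Hk; field; lra.
  - intros q v w Hq; pose proof (punctured_Cmod q Hq) as Hr.
    unfold cone_metric.
    rewrite !d_radius_radial_map, !d_angle_radial_map, Cmod_radial_map by assumption.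
    assert (EL : Rpower (Cmod q) alpha = / Rpower (Cmod q) (c - 1) ^ 2).
    { simpl; rewrite Rmult_1_r, <- Rpower_plus, <- Rpower_Ropp.
      f_equal; rewrite Hca; field. }
    assert (HL : 0 < Rpower (Cmod q) (c - 1)) by apply exp_pos.
    unfold jm_metric; rewrite EL.
    set (L := Rpower (Cmod q) (c - 1)) in *.
    assert (Eq : d_radius q v * d_radius q w + Cmod q ^ 2 * (d_angle q v * d_angle q w)
                 = dot v w).
    { unfold d_radius, d_angle, dot.
      transitivity ((fst q ^ 2 + snd q ^ 2) * dot v w / Cmod q ^ 2).
      - unfold dot; field; lra.
      - rewrite <- Cmod_sqr; unfold dot; field; lra. }
    rewrite <- Eq; field; lra.
Qed.

Lemma cos_sin_eq_iff (a b : R) :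
  (cos a = cos b /\ sin a = sin b) <-> exists k : Z, b = a + IZR k * (2 * PI).
Proof.
  split.
  - intros [Hc Hs].
    (* cos (b - a) = 1 - 2 sin^2 ((b - a) / 2), and the left side is 1. *)
    assert (E : sin ((b - a) / 2) = 0).
    { assert (E : cos (2 * ((b - a) / 2)) = 1).
      { replace (2 * ((b - a) / 2)) with (b - a) by field.
        rewrite cos_minus, Hc, Hs; pose proof (sin2_cos2 b) as H.
        unfold Rsqr in H; lra. }
      rewrite cos_2a_sin in E; nra. }
    destruct (sin_eq_0_0 _ E) as [k Hk]; exists k; lra.
  - intros [k ->].
    assert (E : sin (IZR k * PI) = 0) by (apply sin_eq_0_1; now exists k).
    replace (IZR k * (2 * PI)) with (2 * (IZR k * PI)) by ring.
    rewrite cos_plus, sin_plus, cos_2a_sin, sin_2a, E; split; ring.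
Qed.

Lemma polar_eq_iff (r r' a b : R) :
  0 < r -> 0 < r' ->
  (polar r a = polar r' b <-> r = r' /\ exists k : Z, b = a + IZR k * (2 * PI)).
Proof.
  intros Hr Hr'; split.
  - intros E.
    assert (Er : r = r').
    { rewrite <- (Cmod_polar r a Hr), <- (Cmod_polar r' b Hr'), E; reflexivity. }
    subst r'; split; [reflexivity|].
    injection E as E1 E2; apply cos_sin_eq_iff.
    split; apply Rmult_eq_reg_l with r; lra.
  - intros [-> Hk]; apply cos_sin_eq_iff in Hk; destruct Hk as [E1 E2].
    unfold polar; now rewrite E1, E2.
Qed.

Definition wrap (b : R) (p : C) : C := polar (fst p) (b * snd p).

Definition wrap_term (b : R) (i : axis) : term :=
  Times (Coord ax1) (match i with ax1 => CosY b | ax2 => SinY b end).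

Lemma coord_wrap (b : R) (i : axis) (p : C) :
  coord i (wrap b p) = eval (wrap_term b i) p.
Proof. destruct i; reflexivity. Qed.

Lemma half_plane_punctured (p : C) : half_plane p -> punctured p.
Proof. intros Hp E; unfold half_plane in Hp; rewrite E in Hp; simpl in Hp; lra. Qed.

Lemma differential_wrap (b : R) (p v : C) :
  half_plane p ->
  differential (wrap b) p v
  = (cos (b * snd p) * fst v - fst p * b * sin (b * snd p) * snd v,
     sin (b * snd p) * fst v + fst p * b * cos (b * snd p) * snd v).
Proof.
  intros Hp; apply half_plane_punctured in Hp.
  unfold differential, sum_axis.
  rewrite !(partial_eval _ (wrap_term b ax1) (fun p => fst (wrap b p)))
    by (trivial; intros u _; apply (coord_wrap b ax1)).
  rewrite !(partial_eval _ (wrap_term b ax2) (fun p => snd (wrap b p)))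
    by (trivial; intros u _; apply (coord_wrap b ax2)).
  unfold wrap_term; cbn [dterm eval delta coord].
  f_equal; ring.
Qed.

(** Dividing the angle of the half-plane by |c| turns d phi^2 into
    c^2 d theta^2, and the period 2 PI of theta into 2 PI |c|. *)
Lemma cone_angle (c : R) : c <> 0 -> is_cone_of_angle (2 * PI * Rabs c) (cone_metric c).
Proof.
  intros Hc; assert (Ha : 0 < Rabs c) by now apply Rabs_pos_lt.
  pose proof PI_RGT_0 as HPI.
  split; [apply Rmult_lt_0_compat; lra|].
  exists (wrap (/ Rabs c)); split; [|split; [|split; [|split]]].
  - intros n i; apply Ck_on_sub with punctured; [exact half_plane_punctured|].
    apply Ck_on_eval with (wrap_term (/ Rabs c) i); intros p _; apply coord_wrap.
  - intros p Hp; now apply punctured_polar.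
  - intros q Hq; destruct (polar_exists q Hq) as [theta E].
    exists (Cmod q, Rabs c * theta); split; [now apply punctured_Cmod|].
    unfold wrap; cbn [fst snd].
    replace (/ Rabs c * (Rabs c * theta)) with theta by (field; lra).
    now symmetry.
  - intros p p' Hp Hp'; unfold wrap; rewrite polar_eq_iff by assumption.
    split; intros [E [k Hk]]; (split; [exact E|]); exists k.
    + apply Rmult_eq_reg_l with (/ Rabs c); [|apply Rinv_neq_0_compat; lra].
      rewrite Hk; field; lra.
    + rewrite Hk; field; lra.
  - intros p v w Hp; rewrite !differential_wrap by exact Hp.
    unfold cone_metric, cone_cover_metric, d_radius, d_angle, wrap.
    rewrite Cmod_polar by exact Hp.
    unfold half_plane in Hp; unfold polar, dot; cbn [fst snd].
    assert (E : Rabs c ^ 2 = c ^ 2) by apply pow2_abs.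
    rewrite <- E; set (a := Rabs c) in *; clearbody a.
    set (r := fst p) in *; clearbody r.
    set (phi := / a * snd p); clearbody phi.
    pose proof (sin2_cos2 phi) as H; rewrite !Rsqr_pow2 in H.
    replace (r * cos phi * (cos phi * fst v - r * / a * sin phi * snd v) +
             r * sin phi * (sin phi * fst v + r * / a * cos phi * snd v))
      with (r * (sin phi ^ 2 + cos phi ^ 2) * fst v) by ring.
    replace (r * cos phi * (cos phi * fst w - r * / a * sin phi * snd w) +
             r * sin phi * (sin phi * fst w + r * / a * cos phi * snd w))
      with (r * (sin phi ^ 2 + cos phi ^ 2) * fst w) by ring.
    replace (r * cos phi * (sin phi * fst v + r * / a * cos phi * snd v) -
             r * sin phi * (cos phi * fst v - r * / a * sin phi * snd v))
      with (r ^ 2 * / a * (sin phi ^ 2 + cos phi ^ 2) * snd v) by ring.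
    replace (r * cos phi * (sin phi * fst w + r * / a * cos phi * snd w) -
             r * sin phi * (cos phi * fst w - r * / a * sin phi * snd w))
      with (r ^ 2 * / a * (sin phi ^ 2 + cos phi ^ 2) * snd w) by ring.
    rewrite H; field; lra.
Qed.

Theorem theorem1 (alpha mu c : R) (hmu : 0 < mu) (hc : c = 1 - alpha / 2) :
  (* A *)
  ((forall (I : R -> Prop) (gamma : R -> C),
      geodesic (jm_metric alpha) I gamma ->
      exists (J : R -> Prop) (q : R -> C),
        zero_energy_solution alpha mu J q /\ reparameterization I gamma J q) /\
   (forall (J : R -> Prop) (q : R -> C),
      zero_energy_solution alpha mu J q ->
      exists (I : R -> Prop) (gamma : R -> C),
        geodesic (jm_metric alpha) I gamma /\ reparameterization J q I gamma)) /\
  (* B *)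
  (alpha <> 2 ->
   (exists Phi : C -> C,
      (forall r theta, 0 < r ->
         Phi (polar r theta) = polar (Rpower r c / Rabs c) theta) /\
      isometry (jm_metric alpha) (cone_metric c) Phi) /\
   (exists Phi : C -> C,
      (forall r theta, 0 < r ->
         Phi (polar r theta) = polar (Rpower r c) theta) /\
      homothety (c ^ 2) (jm_metric alpha) (cone_metric c) Phi) /\
   is_cone_of_angle (2 * PI * Rabs c) (cone_metric c)) /\
  (* C *)
  (alpha <> 2 ->
   (forall (A B : C) (I : R -> Prop),
      B <> RtoC 0 -> line_domain A B I ->
      (exists q : R -> C, power_image (/ c) I (line A B) q) /\
      (forall q : R -> C,
         power_image (/ c) I (line A B) q ->
         exists (J : R -> Prop) (p : R -> C),
           zero_energy_solution alpha mu J p /\ reparameterization I q J p) /\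
      (forall z : R -> C,
         folds c I (line A B) z -> geodesic (cone_metric c) I z)) /\
   (forall (I : R -> Prop) (z : R -> C),
      geodesic (cone_metric c) I z ->
      (exists q : R -> C, cone_power_image c I z q) /\
      (forall q : R -> C,
         cone_power_image c I z q ->
         exists (J : R -> Prop) (p : R -> C),
           zero_energy_solution alpha mu J p /\ reparameterization I q J p))).
Proof.
  split; [|split].
  - split; intros.
    + now apply geodesic_to_zero_energy.
    + now apply (zero_energy_to_geodesic alpha mu).
  - intros Hal; assert (Hc : c <> 0) by lra.
    assert (Ha : 0 < Rabs c) by now apply Rabs_pos_lt.
    split; [|split; [|now apply cone_angle]].
    + exists (radial_map (/ Rabs c) (c - 1)); split.
      * intros r theta Hr; rewrite radial_map_polar by exact Hr.
        replace (1 + (c - 1)) with c by ring; f_equal; field; lra.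
      * pose proof (radial_homothety alpha c _ hc Hc (Rinv_0_lt_compat _ Ha)) as H.
        replace ((/ Rabs c) ^ 2 * c ^ 2) with 1 in H
          by (rewrite <- (pow2_abs c); field; lra).
        exact H.
    + exists (radial_map 1 (c - 1)); split.
      * intros r theta Hr; rewrite radial_map_polar by exact Hr.
        replace (1 + (c - 1)) with c by ring; f_equal; ring.
      * pose proof (radial_homothety alpha c 1 hc Hc Rlt_0_1) as H.
        rewrite pow1, Rmult_1_l in H; exact H.
  - intros Hal; assert (Hc : c <> 0) by lra; split.
    + intros A B I HB HI.
      destruct (line_domain_interval A B I HB HI) as [Ho Hp].
      destruct (line_flat_flow A B I HB Ho Hp) as [s [w [HQ Hne]]].
      split; [|split].
      * destruct (log_flow_angle _ _ I (line A B) s w Ho HQ) as [psi Hpsi].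
        now apply (power_image_exists (/ c) I (line A B) psi).
      * intros q; now apply (power_image_zero_energy alpha mu c I (line A B) q s w).
      * intros z Hz; apply geodesic_cone_iff; [exact Hc|]; split; [exact Ho|].
        eexists; eexists; split; [now apply (folds_cone_flow c I (line A B) z s w)|].
        destruct Hne as [t [Ht Hne]]; exists t; split; [exact Ht|]; cbn beta.
        intros E; apply Hne.
        assert (Ew : / c * w t = 0) by nra.
        apply Rmult_integral in Ew; destruct Ew as [Ew | Ew]; [|nra].
        now apply Rinv_neq_0_compat in Ew.
    + intros I z Hz; apply geodesic_cone_iff in Hz; [|exact Hc].
      destruct Hz as [Ho [s [w [HF [t [Ht Hne]]]]]]; split.
      * destruct (log_flow_angle _ _ I z s w Ho HF) as [theta Htheta].
        apply (cone_power_image_exists c I z theta); trivial.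
        intros u Hu; apply HF, Hu.
      * intros q [Q [HQz Hq]].
        pose proof (unfolded_flat_flow c I Q z s w Hc Ho HF HQz) as HQ.
        apply (power_image_zero_energy alpha mu c I Q q _ _ hmu hc Hc Ho HQ); [|exact Hq].
        exists t; split; [exact Ht|]; cbn beta; intros E; apply Hne.
        assert (Ew : c * w t = 0) by nra.
        apply Rmult_integral in Ew; destruct Ew as [Ew | Ew]; [contradiction | nra].
Qed.
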